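(* Let $P_1,\dots,P_s\in\mathbb{C}[X_1,\dots,X_t]$ and $\boldsymbol\alpha_1,\dots,\boldsymbol\alpha_s\in\mathbb{C}^t$. Let $V:=\{\boldsymbol q\in\mathbb{Q}^t:\boldsymbol q\cdot\boldsymbol\alpha_i=\boldsymbol q\cdot\boldsymbol\alpha_{i'}\text{ for all } i,i'\in\{1,\dots,s\}\}$, fix a complement $V'$ of the $\mathbb{Q}$-subspace $V$ in $\mathbb{Q}^t$, and let $\pi':\mathbb{Q}^t\to V'$ be the projection associated with $\mathbb{Q}^t=V\oplus V'$. Then there is an integer $N>0$ such that if $\boldsymbol q\in\mathbb{Q}^t$ is a nondegenerate solution of $$\sum_{i=1}^s P_i(\boldsymbol X)\exp(\boldsymbol X\cdot\boldsymbol\alpha_i)=0,$$ then $\pi'(\boldsymbol q)\in\left(\tfrac1N\mathbb{Z}\right)^t$.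
   Context: Here $\boldsymbol X=(X_1,\dots,X_t)$, $\exp$ is the complex exponential function, and for $\boldsymbol x=(x_1,\dots,x_t)$ and $\boldsymbol\alpha_i=(\alpha_{i1},\dots,\alpha_{it})$ we write $\boldsymbol x\cdot\boldsymbol\alpha_i=x_1\alpha_{i1}+\cdots+x_t\alpha_{it}$. A solution $\boldsymbol a\in\mathbb{C}^t$ of the equation $\sum_{i=1}^s P_i(\boldsymbol X)\exp(\boldsymbol X\cdot\boldsymbol\alpha_i)=0$ is nondegenerate if $\sum_{i\in I}P_i(\boldsymbol a)\exp(\boldsymbol a\cdot\boldsymbol\alpha_i)\neq0$ for every nonempty proper subset $I$ of $\{1,\dots,s\}$. *)

(* Defs.v *)
From mathcomp Require Import all_boot all_order all_algebra.
From mathcomp.real_closed Require Import complex.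
From mathcomp Require Import boolp reals sequences exp trigo.
From mathcomp Require mpoly.

Set Implicit Arguments.
Unset Strict Implicit.
Unset Printing Implicit Defensive.

Import Order.TTheory GRing.Theory Num.Theory.
Local Open Scope ring_scope.
Local Open Scope complex_scope.

Definition cexp (R : realType) (z : R[i]) : R[i] :=
  (expR (complex.Re z))%:C *
  (cos (complex.Im z) +i* sin (complex.Im z)).

Lemma cexp0 (R : realType) : cexp (0 : R[i]) = 1.
Proof. by rewrite /cexp /= expR0 cos0 sin0 mul1r. Qed.

Lemma cexpD (R : realType) (z w : R[i]) : cexp (z + w) = cexp z * cexp w.
Proof.
rewrite /cexp raddfD [complex.Im (z + w)]raddfD /= expRD rmorphM mulrACA.
congr (_ * _); apply/eqP; rewrite eq_complex /= cosD sinD.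
by rewrite eqxx /= addrC (mulrC (cos _) (sin _)).
Qed.

Definition dot (C : pzRingType) (t : nat) (x a : 'rV[C]_t) : C :=
  \sum_(j < t) x 0 j * a 0 j.

Definition rat_point (R : realType) (t : nat) (q : 'rV[rat]_t) : 'rV[R[i]]_t :=
  map_mx ratr q.

Section ExponentialPolynomial.

Variables (R : realType) (s t : nat).
Variables (P : 'I_s -> mpoly.mpoly t R[i]) (alpha : 'I_s -> 'rV[R[i]]_t).

Definition exp_term (a : 'rV[R[i]]_t) (i : 'I_s) : R[i] :=
  mpoly.meval (fun j => a 0 j) (P i) * cexp (dot a (alpha i)).

Definition solution (a : 'rV[R[i]]_t) : Prop :=
  \sum_(i < s) exp_term a i = 0.

Definition nondegenerate_solution (a : 'rV[R[i]]_t) : Prop :=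
  solution a /\
  forall I : {set 'I_s}, I != set0 -> I \proper [set: 'I_s] ->
    \sum_(i in I) exp_term a i != 0.

Definition equal_dots (q : 'rV[rat]_t) : Prop :=
  forall i i' : 'I_s,
    dot (rat_point R q) (alpha i) = dot (rat_point R q) (alpha i').

Lemma equal_dots_linear (c : rat) (u v : 'rV[rat]_t) :
  equal_dots u -> equal_dots v -> equal_dots (c *: u + v).
Proof.
move=> hu hv i i'.
have E k : dot (rat_point R (c *: u + v)) (alpha k) =
    ratr c * dot (rat_point R u) (alpha k) + dot (rat_point R v) (alpha k).
  rewrite /dot mulr_sumr -big_split /=; apply: eq_bigr => j _.
  by rewrite !mxE rmorphD rmorphM /= mulrDl -mulrA.
by rewrite !E (hu i i') (hv i i').
Qed.

Lemma exists_coincidence_space : exists V : {vspace 'rV[rat]_t},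
  forall q, q \in V <-> equal_dots q.
Proof.
pose good n := `[< exists2 V : {vspace 'rV[rat]_t},
  \dim V = n & forall q, q \in V -> equal_dots q >].
have good0 : exists n, good n.
  exists 0%N; apply/asboolP; exists 0%VS; first by rewrite dimv0.
  move=> q; rewrite memv0 => /eqP-> i i'.
  by rewrite /dot !big1 // => j _; rewrite !mxE rmorph0 mul0r.
have good_le n : good n -> (n <= \dim {: 'rV[rat]_t})%N.
  by move=> /asboolP[V <- _]; exact/dimvS/subvf.
case: (ex_maxnP good0 good_le) => n /asboolP[V dimV VP] max_n.
exists V => q; split=> [/VP //|qP]; apply: contrapT => /negP qV.
have /max_n : good (\dim (V + <[q]>)).
  apply/asboolP; exists (V + <[q]>)%VS => // _ /memv_addP[v /VP vP [_ /vlineP[c ->] ->]].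
  by rewrite addrC; exact: equal_dots_linear.
rewrite leqNgt -dimV => /negP; apply.
rewrite ltn_neqAle dimvS ?addvSl // andbT.
apply: contra qV => dimE.
have /eqP-> : V == (V + <[q]>)%VS by rewrite eqEdim addvSl (eqP dimE) leqnn.
by rewrite (subvP (addvSr V <[q]>)) ?memv_line.
Qed.

(* A {vspace _} is a row-reduced matrix, hence the detour through an existence
   proof; [mem_coincidence_space] characterizes the subspace. *)
Definition coincidence_space : {vspace 'rV[rat]_t} :=
  sval (cid exists_coincidence_space).

Lemma mem_coincidence_space (q : 'rV[rat]_t) :
  q \in coincidence_space <-> equal_dots q.
Proof. exact: (svalP (cid exists_coincidence_space)). Qed.

End ExponentialPolynomial.

(* Main.v *)
(** Let E be the exponential, k a finitely generated field containing the
    coefficients of the P_i and the E(alpha_ij), and write a rational solution q as a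
    relation sum c_i E(x_i) = 0 with c_i in k and x_i = q . alpha_i.

    Kummer: an automorphism sigma over k fixing enough roots of unity multiplies each
    E(x_i) by a root of unity it fixes; the powers of sigma give a Vandermonde system,
    so by nondegeneracy sigma fixes E(y) for y = x_i - x_i'.
    Schinzel: then E(y) generates an abelian extension of k, which forces
    E(y)^M to lie in (roots of unity) * k for an M depending only on k.
    Divisibility: if E(x) is in k and x is a rational combination of the alpha_ij, then x has
    bounded denominators modulo 2 pi i.  If some E(alpha_ij) is transcendental, a
    homomorphism from the units of k to Z (order at E(alpha_ij) of a norm) reduces the rank;
    if all are algebraic, only finitely many algebraic numbers in k have conjugates
    and denominators as bounded as those of E(x), x in a fundamental parallelepiped.
    Mann: what remains is a relation between roots of unity over a larger k, whose orders are
    bounded because k has large Galois image on roots of unity.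

    All Galois theory is done with automorphisms of the complex field, obtained
    from Zorn's lemma. *)
Require Import Defs.
From HB Require Import structures.
From mathcomp Require Import all_boot all_order all_algebra.
From mathcomp Require Import all_field.
From mathcomp Require Import cyclic.
From mathcomp.real_closed Require Import complex.
From mathcomp Require Import zify ring lra boolp reals sequences exp trigo.
From mathcomp Require mpoly classical_sets.

Set Implicit Arguments.
Unset Strict Implicit.
Unset Printing Implicit Defensive.

Import Order.TTheory GRing.Theory Num.Theory.
Local Open Scope ring_scope.

(** * Subfields and algebraic elements *)

(** The coefficients P_i(q) vary with the solution q, and so does an exponent M with all E(x_i)^M in
    k, so every bound has to be uniform in both. Of the coefficients, only membership in k enters. M
    is removed in two stages. Schinzel's step trades it for an exponent M1 that depends only on k,
    at the price of a root of unity of unbounded order, that is, of an unknown rational multiple of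
    the period; Mann's step then bounds that multiple. Mann's step has to wait for the divisibility
    step, because it needs one finitely generated field that contains all remaining coefficients:
    this field arises by adjoining the E(alpha_ij / N2), with N2 already uniform. Only the
    differences x_i - x_i' are ever controlled, because a relation may be rescaled by a common
    factor; hence V is defined by equality of the q . alpha_i, and only the component of q in V' is
    bounded. *)

Section DirectedZorn.
Import classical_sets.
Local Open Scope classical_set_scope.

(** The second hypothesis is finite character in directed form: a set is good once each finite list
    from it lies in a good subset. Closure under operations and absence of a bad finite list are
    both of this kind. *)
Lemma Zorn_directed (T : eqType) (good : set T -> Prop) (A0 : set T) :
    good A0 ->
    (forall U, (forall l : seq T, (forall x, x \in l -> U x) ->
       exists X, [/\ good X, X `<=` U & forall x, x \in l -> X x]) -> good U) ->
  exists A, [/\ good A, A0 `<=` A & forall B, good B -> A `<=` B -> B `<=` A].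
Proof.
move=> good0 goodU.
(* Zorn's lemma is run on the sets whose union with [A0] is good; this forces [A0] into the maximal
   set and leaves [A0] itself for the empty chain. *)
have [|A [Agood Amax]] := @Zorn_bigcup T (fun X => good (X `|` A0)); last first.
  exists (A `|` A0); split=> // B Bgood AB x Bx; left; apply: contrapT => nAx.
  have A0B : A0 `<=` B by move=> y yA; apply: AB; right.
  apply: (Amax B); last by rewrite (setUidl A0B).
  by split=> [y Ay|BA]; [apply: AB; left | apply/nAx/BA].
move=> F Fgood Ftot; apply: goodU => l lU.
suff [X [FX lX]] : exists X, (F X \/ X = set0) /\ forall x, x \in l -> (X `|` A0) x.
  exists (X `|` A0); split=> //; first by case: FX => [/Fgood//|->]; rewrite set0U.
  by apply: setSU; case: FX => [FX|->]; [exact: bigcup_sup | exact: sub0set].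
elim: l lU => [|x l IHl] lU; first by exists set0; split=> //; right.
have [|X [FX lX]] := IHl; first by move=> y yl; apply: lU; rewrite inE yl orbT.
have [[Y FY Yx]|xA0] := lU x (mem_head _ _); last first.
  by exists X; split=> // y; rewrite inE => /orP[/eqP->|/lX//]; right.
have [XY|YX] : (X `<=` Y) \/ (Y `<=` X).
- by case: FX => [FX|->]; [exact: Ftot | left; exact: sub0set].
- exists Y; split=> [|y]; first by left.
  rewrite inE => /orP[/eqP->|/lX[Xy|yA]]; [by left | | by right].
  by left; apply: XY.
- exists X; split=> // y; rewrite inE => /orP[/eqP->|/lX//].
  by left; apply: YX.
Qed.

End DirectedZorn.

Section Subfield.
Import classical_sets.
Local Open Scope classical_set_scope.
Variable C : fieldType.

(** Turns a predicate into a type, so that [val] is a morphism and library facts on [algebraicOver]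
    apply; elsewhere subfields stay predicates, which keeps inclusions and Zorn's lemma simple. *)
Record subfield_elt (F : {pred C}) := SubfieldElt {
  subfield_val : C; _ : subfield_val \in F }.

HB.instance Definition _ (F : {pred C}) := [isSub for @subfield_val F].
HB.instance Definition _ (F : {pred C}) := [Choice of subfield_elt F by <:].

Section Structures.
Variable F : divringClosed C.
HB.instance Definition _ := [SubChoice_isSubIntegralDomain of subfield_elt F by <:].
HB.instance Definition _ := [SubIntegralDomain_isSubField of subfield_elt F by <:].
End Structures.

Definition alg (F : {pred C}) (x : C) : Prop :=
  exists p : {poly C}, [/\ p \is a polyOver F, p != 0 & root p x].

Lemma algP (F : divringClosed C) x :
  alg F x <-> algebraicOver (val : subfield_elt F -> C) x.
Proof.
split=> [[p [/polyOverP pF p0 rp]]|[p p0 rp]]; last first.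
  exists (map_poly val p); split=> //; last by rewrite map_poly_eq0.
  by apply/polyOverP => i; rewrite coef_map; apply: valP.
pose q : {poly subfield_elt F} := \poly_(i < size p) insubd 0 p`_i.
have qp : map_poly val q = p.
  apply/polyP => i; rewrite coef_map coef_poly.
  case: ltnP => [_|/(nth_default 0)->]; last exact: rmorph0.
  exact: (insubdK _ (pF i)).
by exists q; rewrite ?qp // -(map_poly_eq0 val) qp.
Qed.

Lemma alg_mem (F : divringClosed C) x : x \in F -> alg F x.
Proof.
move=> xF; exists ('X - x%:P); split; first by rewrite polyOverXsubC.
  by rewrite polyXsubC_eq0.
by rewrite root_XsubC.
Qed.

Lemma alg_sub (F : divringClosed C) x y : alg F x -> alg F y -> alg F (x - y).
Proof. by move=> /algP ax /algP ay; apply/algP/(@algebraic_sub _ _ val). Qed.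

Lemma alg_div (F : divringClosed C) x y : alg F x -> alg F y -> alg F (x / y).
Proof. by move=> /algP ax /algP ay; apply/algP/(@algebraic_div _ _ val). Qed.

Lemma alg_sub_field (F G : {pred C}) x : {subset F <= G} -> alg F x -> alg G x.
Proof. by move=> FG [p [pF p0 r]]; exists p; split=> //; apply: polyOverS pF. Qed.

(** Over a field algebraic means integral, and integrality is transitive. *)
Lemma alg_root (F : divringClosed C) (p : {poly C}) x :
  p != 0 -> (forall i, alg F p`_i) -> root p x -> alg F x.
Proof.
move=> p0 pa rx; apply/algP/integral_algebraic.
apply: (integral_root p0 rx); apply/integral_poly => i.
exact/integral_algebraic/algP/pa.
Qed.

Definition alg_closure (F : {pred C}) : {pred C} := fun x => `[< alg F x >].

Lemma alg_closureP (F : {pred C}) x : reflect (alg F x) (x \in alg_closure F).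
Proof. exact: asboolP. Qed.

Lemma alg_closure_closed (F : divringClosed C) : divring_closed (alg_closure F).
Proof.
split.
- by apply/alg_closureP/alg_mem; rewrite rpred1.
- by move=> x y /alg_closureP ax /alg_closureP ay; apply/alg_closureP/alg_sub.
- by move=> x y /alg_closureP ax /alg_closureP ay; apply/alg_closureP/alg_div.
Qed.
HB.instance Definition _ (F : divringClosed C) :=
  GRing.isDivringClosed.Build C (alg_closure F) (alg_closure_closed F).

Definition adjoin (F : {pred C}) (w : C) : {pred C} := fun y =>
  `[< exists f g : {poly C}, [/\ f \is a polyOver F, g \is a polyOver F,
        g.[w] != 0 & y = f.[w] / g.[w]] >].

Lemma adjoinP (F : {pred C}) w y : reflect
  (exists f g : {poly C}, [/\ f \is a polyOver F, g \is a polyOver F,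
        g.[w] != 0 & y = f.[w] / g.[w]]) (y \in adjoin F w).
Proof. exact: asboolP. Qed.

Lemma adjoin_closed (F : divringClosed C) w : divring_closed (adjoin F w).
Proof.
split.
- apply/adjoinP; exists 1, 1; rewrite rpred1 hornerC oner_eq0 divr1; split=> //.
- move=> x y /adjoinP[f [g [fF gF g0 ->]]] /adjoinP[f' [g' [fF' gF' g0' ->]]].
  apply/adjoinP; exists (f * g' - f' * g), (g * g').
  rewrite rpredB ?rpredM // hornerM mulf_neq0 //; split=> //.
  by rewrite hornerD hornerN !hornerM -mulNr addf_div // mulNr.
- move=> x y /adjoinP[f [g [fF gF g0 ->]]] /adjoinP[f' [g' [fF' gF' g0' ->]]].
  (* If the divisor is zero, so is the quotient, by the convention for inverses. *)
  apply/adjoinP; have [f0|f0] := eqVneq f'.[w] 0.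
    exists 0, 1; rewrite rpred0 rpred1 hornerC oner_eq0 f0; split=> //.
    by rewrite mul0r invr0 mulr0 horner0 mul0r.
  exists (f * g'), (g * f'); rewrite !rpredM // !hornerM mulf_neq0 //; split=> //.
  by rewrite invf_div mulf_div.
Qed.
HB.instance Definition _ (F : divringClosed C) w :=
  GRing.isDivringClosed.Build C (adjoin F w) (adjoin_closed F w).

Lemma adjoin_sub (F : divringClosed C) w : {subset F <= adjoin F w}.
Proof.
move=> x xF; apply/adjoinP; exists x%:P, 1.
by rewrite polyOverC xF rpred1 !hornerC oner_eq0 divr1.
Qed.

Lemma adjoin_gen (F : divringClosed C) w : w \in adjoin F w.
Proof.
apply/adjoinP; exists 'X, 1.
by rewrite polyOverX rpred1 !hornerC hornerX oner_eq0 divr1.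
Qed.

(* If y = f(w)/g(w) is algebraic over F and f <> y g, then w, a root of f - y g,
   would be too. *)
Lemma alg_adjoin_transcendental (F : divringClosed C) w y :
  ~ alg F w -> y \in adjoin F w -> alg F y -> y \in F.
Proof.
move=> nw /adjoinP[f [g [/polyOverP fF /polyOverP gF g0 yE]]] ay.
have [fg|fg] := eqVneq (f - y *: g) 0; last first.
  case: nw; apply: (alg_root fg); last first.
    by rewrite /root !hornerE yE divfK // subrr.
  move=> i; rewrite coefB coefZ; apply/alg_closureP.
  by rewrite rpredB ?rpredM //; apply/alg_closureP => //; apply: alg_mem.
have /(congr1 (coefp (size g).-1)) : f = y *: g by apply/eqP; rewrite -subr_eq0 fg.
rewrite /= coefZ => E; have -> : y = f`_(size g).-1 / g`_(size g).-1.
  rewrite E mulfK //.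
  by rewrite -lead_coefE lead_coef_eq0; apply: contraNneq g0 => ->; rewrite horner0.
by rewrite rpred_div.
Qed.

Lemma common_denominator (F : divringClosed C) w (p : {poly C}) :
  p \is a polyOver (adjoin F w) -> exists (h : {poly C}) (P : nat -> {poly C}),
    [/\ h \is a polyOver F, h.[w] != 0 & forall i,
      P i \is a polyOver F /\ h.[w] * p`_i = (P i).[w]].
Proof.
move=> /polyOverP pF.
suff [h [P [hF h0 hP]]] : exists (h : {poly C}) (P : nat -> {poly C}),
    [/\ h \is a polyOver F, h.[w] != 0 & forall i, (i < size p)%N ->
      P i \is a polyOver F /\ h.[w] * p`_i = (P i).[w]].
  exists h, (fun i => if (i < size p)%N then P i else 0); split=> // i.
  case: ltnP => [/hP//|/(nth_default 0)->].
  by rewrite rpred0 horner0 mulr0.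
elim: (size p) => [|n [h [P [hF h0 hP]]]].
  by exists 1, (fun _ => 0); rewrite rpred1 hornerC oner_eq0; split.
have /adjoinP[f [g [fF gF g0 pE]]] := pF n.
exists (h * g), (fun i => if i == n then f * h else P i * g).
rewrite rpredM // hornerM mulf_neq0 //; split=> // i; rewrite ltnS leq_eqVlt.
case: eqP => [->|_] /= => [_|/hP[PF PE]]; rewrite rpredM // hornerM; split=> //.
  by rewrite pE -mulrA (mulrC g.[w]) divfK // mulrC.
by rewrite mulrAC PE.
Qed.

(** Steinitz exchange: with denominators cleared, the relation for [g] over F(w) becomes a
    polynomial in [w] over F(g). If it vanished identically, its coefficient at a suitable power of
    [w] would be a nontrivial relation for [g] over [F]. *)
Lemma alg_exchange (F : divringClosed C) w g :
  ~ alg F g -> alg (adjoin F w) g -> alg (adjoin F g) w.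
Proof.
move=> ng [p [/common_denominator[h [P [hF h0 hP]]] p0 rg]].
pose Q := \sum_(i < size p) g ^+ i *: P i.
have QE : Q.[w] = 0.
  transitivity (h.[w] * p.[g]); last by rewrite (eqP rg) mulr0.
  rewrite horner_sum (horner_coef p) mulr_sumr.
  by apply: eq_bigr => i _; rewrite hornerZ mulrC -(hP i).2 mulrA.
exists Q; split; last by rewrite /root QE.
  apply: rpred_sum => i _; apply: polyOverZ; first by rewrite rpredX ?adjoin_gen.
  by apply: polyOverS (hP i).1; apply: adjoin_sub.
apply/eqP => Q0; have [j Pj] : exists j, (P (size p).-1)`_j != 0.
  apply: contrapT => Pj; move: p0; apply/negP; rewrite negbK -lead_coef_eq0.
  rewrite lead_coefE -(mulrI_eq0 _ (@mulfI _ _ h0)) (hP _).2.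
  have -> : P (size p).-1 = 0; last by rewrite horner0.
  by apply/polyP => j; rewrite coef0; apply: contrapT => /eqP Pj0; apply: Pj; exists j.
case: ng; exists (\poly_(i < size p) (P i)`_j); split.
- by apply/polyOverP => i; rewrite coef_poly; case: ifP => _; [exact: (polyOverP (hP i).1) | exact: rpred0].
- apply: contraNneq Pj => /(congr1 (coefp (size p).-1)); rewrite /= coef_poly coef0.
  by rewrite ltn_predL size_poly_gt0 p0 => ->.
have := congr1 (coefp j) Q0; rewrite /= coef_sum coef0 /root horner_poly => E.
by apply/eqP; rewrite -[RHS]E; apply: eq_bigr => i _; rewrite coefZ mulrC.
Qed.

Definition divring_of (A : {pred C}) (h : divring_closed A) : divringClosed C :=
  HB.pack A (GRing.isDivringClosed.Build C A h).

(** Badness is tested on finite lists, so its absence passes to directed unions. A list can hold a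
    forbidden element or the coefficients of a forbidden polynomial, which covers all the maximal
    fields built below. *)
Lemma maximal_subfield (bad : seq C -> Prop) (A0 : divringClosed C) :
    (forall l, {subset l <= A0} -> ~ bad l) ->
  exists A : divringClosed C, [/\ {subset A0 <= A},
    forall l, {subset l <= A} -> ~ bad l &
    forall B : divringClosed C, {subset A <= B} ->
      (forall l, {subset l <= B} -> ~ bad l) -> {subset B <= A}].
Proof.
move=> good0; pose pr (X : set C) : {pred C} := fun x => `[< X x >].
have prP X x : reflect (X x) (x \in pr X) by exact: asboolP.
pose good X := divring_closed (pr X) /\ forall l, {subset l <= pr X} -> ~ bad l.
have goodE (B : divringClosed C) :
    (forall l, {subset l <= B} -> ~ bad l) -> good [set x | x \in B].
  move=> Bbad; have E : pr [set x | x \in B] =i B by move=> x; apply/prP/idP.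
  split; last by move=> l lB; apply: Bbad => y /lB; rewrite E.
  by split=> [|x y|x y]; rewrite !E; [exact: rpred1 | exact: rpredB | exact: rpred_div].
have [U Ugood|A [[Acl Abad] A0A Amax]] := Zorn_directed (goodE _ good0); last first.
  exists (divring_of Acl); split=> //= [x xA|B AB /goodE Bgood x xB].
    exact/prP/A0A.
  by apply/prP/(Amax _ Bgood) => // y Ay; apply/AB/prP.
have fin (l : seq C) : {subset l <= pr U} -> exists X,
    [/\ good X, {subset pr X <= pr U} & {subset l <= pr X}].
  move=> lU; have [|X [gX XU lX]] := Ugood l; first by move=> x /lU/prP.
  by exists X; split=> // x => [/prP/XU/prP|/lX/prP].
split; last by move=> l /fin[X [[_ Xbad] _ lX]]; apply: Xbad.
split.
- by have [//|X [[[X1 _ _] _] XU _]] := fin [::]; apply: XU.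
- move=> x y xU yU; have [|X [[[_ Xsub _] _] XU lX]] := fin [:: x; y].
    by move=> u; rewrite in_cons mem_seq1 => /orP[]/eqP->.
  by apply: XU; apply: Xsub; apply: lX; rewrite in_cons mem_seq1 eqxx ?orbT.
- move=> x y xU yU; have [|X [[[_ _ Xdiv] _] XU lX]] := fin [:: x; y].
    by move=> u; rewrite in_cons mem_seq1 => /orP[]/eqP->.
  by apply: XU; apply: Xdiv; apply: lX; rewrite in_cons mem_seq1 eqxx ?orbT.
Qed.

(* Maximality forces C to be algebraic over the field: adjoining a transcendental
   element would create no new algebraic element. *)
Lemma avoiding_subfield (k : divringClosed C) z : z \notin k -> alg k z ->
  exists K : divringClosed C, [/\ {subset k <= K}, z \notin K & forall x, alg K x].
Proof.
move=> zk az; have [l /[swap] zl /(_ _ zl)|K [kK Kbad Kmax]] :=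
    @maximal_subfield (fun l => z \in l) k.
  by apply/negP.
have zK : z \notin K.
  by apply/negP => zK; apply: (Kbad [:: z]); rewrite ?inE // => x; rewrite inE => /eqP->.
exists K; split=> // w; apply: contrapT => nw.
have /negP := zK; apply.
apply: (alg_adjoin_transcendental nw); last exact: alg_sub_field az.
apply: contrapT => /negP zKw; apply: nw; apply: alg_mem.
apply: (Kmax (adjoin K w)); last exact: adjoin_gen.
  exact: adjoin_sub.
by move=> l lK zl; move: zKw; rewrite lK.
Qed.

(** Used with [k] the rationals: [K] contains no new algebraic numbers, so roots of unity keep over
    [K] their full Galois group, while all of [C] is algebraic over [K]. *)
Lemma relatively_closed_subfield (k : divringClosed C) :
  exists K : divringClosed C, [/\ {subset k <= K},
    (forall x, x \in K -> alg k x -> x \in k) & forall x, alg K x].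
Proof.
have [l lk [x [xl ax]]|K [kK Kbad Kmax]] :=
    @maximal_subfield (fun l => exists x, [/\ x \in l, alg k x & x \notin k]) k.
  by rewrite lk.
have Kk x : x \in K -> alg k x -> x \in k.
  move=> xK ax; apply: contrapT => /negP xk; apply: (Kbad [:: x]).
    by move=> y; rewrite inE => /eqP->.
  by exists x; rewrite inE.
exists K; split=> // w; apply: contrapT => nw; apply: (nw); apply: alg_mem.
apply: (Kmax (adjoin K w)); last exact: adjoin_gen.
  exact: adjoin_sub.
move=> l lK [x [/lK xK ax /negP[]]]; apply: Kk => //.
by apply: (alg_adjoin_transcendental nw) => //; apply: alg_sub_field ax.
Qed.

(** [K] is maximal with [g] transcendental over it. If [w] were transcendental over K(g), then by
    exchange [g] would be transcendental over K(w), against maximality. *)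
Lemma transcendental_subfield (k : divringClosed C) g : ~ alg k g ->
  exists K : divringClosed C, [/\ {subset k <= K}, ~ alg K g & forall x, alg (adjoin K g) x].
Proof.
pose bad (l : seq C) := exists p : {poly C}, [/\ p = l :> seq C, p != 0 & root p g].
have algE (F : divringClosed C) : alg F g <-> exists2 l, {subset l <= F} & bad l.
  split=> [[p [/polyOverP pF p0 rp]]|[l lF [p [pl p0 rp]]]].
    by exists (polyseq p); [move=> _ /(nthP 0)[i _ <-] | exists p].
  exists p; split=> //; apply/polyOverP => i; have [li|li] := ltnP i (size p).
    by apply: lF; rewrite -pl mem_nth.
  by rewrite nth_default // rpred0.
move=> ng; have [l lk bl|K [kK Kbad Kmax]] := @maximal_subfield bad k.
  by apply: ng; apply/algE; exists l.
have nKg : ~ alg K g by move=> /algE[l /Kbad].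
exists K; split=> // w; apply: contrapT => nw; apply: (nw).
suff ag : alg (adjoin K w) g by apply: alg_exchange.
apply: contrapT => nag; apply: nw; apply/alg_mem/adjoin_sub.
apply: (Kmax (adjoin K w)); last exact: adjoin_gen.
  exact: adjoin_sub.
by move=> l lK bl; apply: nag; apply/algE; exists l.
Qed.

End Subfield.

Lemma alg_coef0 (C : fieldType) (F : divringClosed C) x : alg F x -> x != 0 ->
  exists p : {poly C}, [/\ p \is a polyOver F, p`_0 != 0 & root p x].
Proof.
move=> [p [pF p0 rx]] x0; elim: {p}(size p) {-2}p (leqnn (size p)) pF p0 rx => [|n IHn] p.
  by rewrite size_poly_leq0 => /eqP-> _ /eqP.
move=> sp /polyOverP pF p0 rx; have [p00|] := eqVneq p`_0 0; last first.
  by exists p; split=> //; apply/polyOverP.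
have pE : p = drop_poly 1 p * 'X.
  apply/polyP => -[|i]; rewrite coefMX /= ?p00 // coef_drop_poly addn1 //.
apply: (IHn (drop_poly 1 p)).
- by rewrite size_drop_poly leq_subLR.
- by apply/polyOverP => i; rewrite coef_drop_poly.
- by apply: contraNneq p0 => E; rewrite pE E mul0r.
- by move: rx; rewrite {1}pE rootM rootX (negPf x0) orbF.
Qed.

(** * Extension of partial embeddings *)

Section PartialIso.
Import classical_sets.
Local Open Scope classical_set_scope.
Variables (C : closedFieldType) (K : divringClosed C).
Hypothesis algK : forall x, alg K x.

(* A partial embedding of C over K, encoded as its graph. *)
Definition partial_hom (S : {pred C * C}) : Prop :=
  [/\ subring_closed S, forall x, x \in K -> (x, x) \in S &
      forall y, (0, y) \in S -> y = 0].

Lemma diag_partial_hom : partial_hom [pred xy | (xy.1 \in K) && (xy.1 == xy.2)].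
Proof.
split=> [|x xK|y]; last by rewrite inE /= => /andP[_ /eqP].
  split=> [|[x x'] [y y']|[x x'] [y y']]; rewrite !inE /=.
  - by rewrite rpred1 eqxx.
  - by move=> /andP[xK /eqP<-] /andP[yK /eqP<-]; rewrite rpredB // eqxx.
  - by move=> /andP[xK /eqP<-] /andP[yK /eqP<-]; rewrite rpredM // eqxx.
by rewrite inE /= xK eqxx.
Qed.

Section Extend.
Variable S : subringClosed (C * C)%type.
Hypothesis Shom : partial_hom S.

Lemma horner_fst (F : {poly C * C}) x : F.[x].1 = (map_poly fst F).[x.1].
Proof. by rewrite horner_map. Qed.

Lemma horner_snd (F : {poly C * C}) x : F.[x].2 = (map_poly snd F).[x.2].
Proof. by rewrite horner_map. Qed.

Lemma partial_hom_map (F : {poly C}) x y : F \is a polyOver K -> (x, y) \in S ->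
  (F.[x], F.[y]) \in S.
Proof.
move=> + xyS; have [_ SK _] := Shom.
elim/poly_ind: F => [_|p c IHp /polyOverP pF]; first by rewrite !horner0 SK ?rpred0.
have pcE i : (p * 'X + c%:P)`_i = if i is j.+1 then p`_j else c.
  by case: i => [|i]; rewrite coefD coefMX coefC ?add0r ?addr0.
rewrite !hornerE; have -> : (p.[x] * x + c, p.[y] * y + c) =
  (p.[x], p.[y]) * (x, y) + (c, c) :> C * C by [].
rewrite rpredD ?rpredM //; last by apply: SK; have := pF 0%N; rewrite pcE.
by apply: IHp; apply/polyOverP => i; have := pF i.+1; rewrite pcE.
Qed.

(** A polynomial over [K] that kills [x] and has constant term c != 0 sends (x, 0) to (0, c), which
    the last clause of [partial_hom] forbids. *)
Lemma partial_hom_inj x : (x, 0) \in S -> x = 0.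
Proof.
move=> xS; apply: contrapT => /eqP x0.
have [p [pF p0 /eqP rp]] := alg_coef0 (algK x) x0.
have := partial_hom_map pF xS; have [_ _ S0] := Shom.
by rewrite /= rp => /S0/eqP; rewrite horner_coef0 (negPf p0).
Qed.

Lemma lead_fst F : F \is a polyOver S -> F != 0 -> (lead_coef F).1 != 0.
Proof.
move=> /polyOverP FS F0; apply: contraNneq F0 => lF.
rewrite -lead_coef_eq0; have [_ _ S0] := Shom.
have := FS (size F).-1; rewrite -lead_coefE.
by case: (lead_coef F) lF => a b /= -> /S0 ->.
Qed.

Lemma lead_snd F : F \is a polyOver S -> F != 0 -> (lead_coef F).2 != 0.
Proof.
move=> /polyOverP FS F0; apply: contraNneq F0 => lF.
rewrite -lead_coef_eq0.
have := FS (size F).-1; rewrite -lead_coefE.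
by case: (lead_coef F) lF => a b /= -> /partial_hom_inj ->.
Qed.

Variables (w w' : C) (M : {poly C * C}).
Hypotheses (MS : M \is a polyOver S) (M0 : M != 0) (rM : M.[(w, w')] = 0).
Hypothesis Mmin : forall F, F \is a polyOver S -> F != 0 ->
  (map_poly fst F).[w] = 0 -> (size M <= size F)%N.

(** [M] encodes a minimal polynomial of [w] (first components) together with its image (second
    components), which kills [w']. Pseudo-division by [M] shortens [F], keeps the first value 0 and
    multiplies the second by a nonzero constant; [S] is only a subring, so leading coefficients are
    cross-multiplied, not divided. *)
Lemma extend_functional F y : F \is a polyOver S -> F.[(w, w')] = (0, y) -> y = 0.
Proof.
elim: {F}(size F) {-2}F (leqnn (size F)) y => [|n IHn] F.
  by rewrite size_poly_leq0 => /eqP-> y _; rewrite horner0 => -[].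
move=> sF y FS FE; have [F0|F0] := eqVneq F 0.
  by move: FE; rewrite F0 horner0 => -[].
have sMF : (size M <= size F)%N.
  apply: Mmin => //; have := congr1 fst FE; by rewrite horner_fst.
pose G := lead_coef M *: F - lead_coef F *: M * 'X^(size F - size M).
have GS : G \is a polyOver S.
  rewrite rpredB ?rpredM ?polyOverXn ?polyOverZ //.
  - exact: (polyOverP MS).
  - exact: (polyOverP FS).
have GE : G.[(w, w')] = (0, (lead_coef M).2 * y).
  rewrite !hornerE rM mulr0 mul0r subr0 FE.
  by apply/eqP; rewrite xpair_eqE /= mulr0 !eqxx.
suff /IHn/(_ _ GS GE) : (size G <= n)%N.
  by move/eqP; rewrite mulf_eq0 (negPf (lead_snd MS M0)) => /eqP.
have sF0 : (0 < size F)%N by rewrite size_poly_gt0.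
apply: (@leq_trans (size F).-1); last by rewrite -ltnS prednK.
apply/leq_sizeP => j; rewrite leq_eqVlt => /orP[/eqP<-|].
  rewrite coefB -scalerAl !coefZ coefMXn -lead_coefE.
  have sM0 : (0 < size M)%N by rewrite size_poly_gt0.
  case: ltnP => [lt|_].
    by exfalso; lia.
  have -> : ((size F).-1 - (size F - size M) = (size M).-1)%N by lia.
  by rewrite -lead_coefE mulrC subrr.
rewrite prednK // => jF; rewrite coefB -scalerAl !coefZ coefMXn.
rewrite nth_default // mulr0 sub0r; case: ltnP => [_|_]; first by rewrite mulr0 oppr0.
by rewrite [M`__]nth_default ?mulr0 ?oppr0 // -{1}(subKn sMF) leq_sub2r.
Qed.

Definition extension : {pred C * C} :=
  fun xy => `[< exists2 F, F \is a polyOver S & xy = F.[(w, w')] >].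

Lemma extensionP xy : reflect (exists2 F, F \is a polyOver S & xy = F.[(w, w')])
  (xy \in extension).
Proof. exact: asboolP. Qed.

Lemma extension_sub : {subset S <= extension}.
Proof. by move=> xy xyS; apply/extensionP; exists xy%:P; rewrite ?polyOverC ?hornerC. Qed.

Lemma extension_gen : (w, w') \in extension.
Proof. by apply/extensionP; exists 'X; rewrite ?polyOverX ?hornerX. Qed.

Lemma extension_partial_hom : partial_hom extension.
Proof.
have [_ SK _] := Shom; split; last by move=> y /extensionP[F FS /esym/extend_functional->].
  split.
  - by apply: extension_sub; rewrite rpred1.
  - move=> _ _ /extensionP[F FS ->] /extensionP[G GS ->].
    by apply/extensionP; exists (F - G); rewrite ?rpredB ?hornerE.
  - move=> _ _ /extensionP[F FS ->] /extensionP[G GS ->].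
    by apply/extensionP; exists (F * G); rewrite ?rpredM ?hornerM.
by move=> x xK; apply/extension_sub/SK.
Qed.

End Extend.

Lemma aut_of_partial_hom (S : subringClosed (C * C)%type) : partial_hom S ->
    (forall x, exists y, (x, y) \in S) ->
  exists sigma : {rmorphism C -> C},
    (forall x y, (x, y) \in S -> sigma x = y).
Proof.
move=> [_ _ S0] /choice[f fS].
have uniq x y y' : (x, y) \in S -> (x, y') \in S -> y = y'.
  move=> h h'; apply/eqP; rewrite -subr_eq0; apply/eqP/S0.
  by rewrite -(subrr x); apply: (rpredB h h').
have fB : zmod_morphism f by move=> x y; apply: (uniq (x - y)) => //; exact: (rpredB (fS x) (fS y)).
have fM : monoid_morphism f.
  split; first by apply: (uniq 1) => //; exact: (rpred1 S).
  by move=> x y; apply: (uniq (x * y)) => //; exact: (rpredM (fS x) (fS y)).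
pose sigma : {rmorphism C -> C} := HB.pack f (GRing.isZmodMorphism.Build C C f fB)
  (GRing.isMonoidMorphism.Build C C f fM).
by exists sigma => x y xyS; apply: (uniq x _ _ (fS x)).
Qed.

(** A constant [M] could not vanish at [w]; so the image polynomial is nonconstant and has a root,
    to which [w] can be sent. *)
Lemma minimal_poly (S : subringClosed (C * C)%type) w : partial_hom S ->
  exists M : {poly C * C}, [/\ M \is a polyOver S, M != 0, (map_poly fst M).[w] = 0,
  forall F, F \is a polyOver S -> F != 0 ->
    (map_poly fst F).[w] = 0 -> (size M <= size F)%N &
  (1 < size (map_poly snd M))%N].
Proof.
move=> Shom; have [_ SK S0] := Shom.
pose P n := `[< exists M : {poly C * C}, [/\ M \is a polyOver S, M != 0,
   (map_poly fst M).[w] = 0 & size M = n] >].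
have exP : exists n, P n.
  have [p [/polyOverP pK p0 rp]] := algK w.
  have cp i : (\poly_(i < size p) (p`_i, p`_i) : {poly C * C})`_i = (p`_i, p`_i).
    by rewrite coef_poly; case: ltnP => // /(nth_default 0) ->.
  exists (size (\poly_(i < size p) (p`_i, p`_i) : {poly C * C})); apply/asboolP.
  exists (\poly_(i < size p) (p`_i, p`_i)); split=> //.
  - by apply/polyOverP => i; rewrite cp; apply: SK.
  - apply: contraNneq p0 => E; apply/eqP/polyP => i.
    by have := cp i; rewrite E !coef0 => -[].
  - rewrite -[RHS](eqP rp); congr (_.[w]).
    by apply/polyP => i; rewrite coef_map cp.
case: (ex_minnP exP) => n /asboolP[M [MS M0 rM sM]] nmin.
exists M; split=> // [F FS F0 rF|].
  by rewrite sM; apply: nmin; apply/asboolP; exists F.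
rewrite size_map_poly_id0; last exact: (lead_snd Shom MS M0).
rewrite ltnNge; apply/negP => /size1_polyC ME.
move: rM; rewrite ME map_polyC hornerC /= => M00.
have := lead_fst Shom MS M0; rewrite ME lead_coefC.
by rewrite M00 eqxx.
Qed.

(** A maximal graph is total, since a missing [x] could be added with a root of the image of its
    minimal polynomial. This gives an endomorphism; bijectivity comes from [fixes_bij]. *)
Lemma embedding_extends (S : subringClosed (C * C)%type) : partial_hom S ->
  exists sigma : {rmorphism C -> C}, forall x y, (x, y) \in S -> sigma x = y.
Proof.
pose pr (X : set (C * C)) : {pred C * C} := fun x => `[< X x >].
have prP X x : reflect (X x) (x \in pr X) by exact: asboolP.
pose good X := partial_hom (pr X).
move=> Shom; have [|U Ugood|A [Agood SA Amax]] := @Zorn_directed _ good [set x | x \in S].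
- suff E : pr [set x | x \in S] = S by rewrite /good E.
  by apply/funext => x; apply/prP/idP.
- have fin (l : seq (C * C)) : {subset l <= pr U} -> exists X,
      [/\ good X, {subset pr X <= pr U} & {subset l <= pr X}].
    move=> lU; have [|X [gX XU lX]] := Ugood l; first by move=> x /lU/prP.
    by exists X; split=> // x => [/prP/XU/prP|/lX/prP].
  split; last first.
  + move=> y yU; have [|X [[_ _ X0] _ lX]] := fin [:: (0, y)].
      by move=> u; rewrite mem_seq1 => /eqP->.
    by apply: X0; apply: lX; rewrite mem_seq1.
  + by move=> x xK; have [//|X [[_ XK _] XU _]] := fin [::]; apply/XU/XK.
  split.
  + by have [//|X [[[X1 _ _] _ _] XU _]] := fin [::]; apply: XU.
  + move=> x y xU yU; have [|X [[[_ Xsub _] _ _] XU lX]] := fin [:: x; y].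
      by move=> u; rewrite in_cons mem_seq1 => /orP[]/eqP->.
    by apply: XU; apply: Xsub; apply: lX; rewrite in_cons mem_seq1 eqxx ?orbT.
  + move=> x y xU yU; have [|X [[[_ _ Xdiv] _ _] XU lX]] := fin [:: x; y].
      by move=> u; rewrite in_cons mem_seq1 => /orP[]/eqP->.
    by apply: XU; apply: Xdiv; apply: lX; rewrite in_cons mem_seq1 eqxx ?orbT.
have [Acl _ _] := Agood.
pose A' : subringClosed (C * C)%type := HB.pack (pr A)
  (GRing.isSubringClosed.Build (C * C)%type (pr A) Acl).
have A'hom : partial_hom A' by exact: Agood.
have [x|sigma sigmaP] := aut_of_partial_hom A'hom.
  have [M [MA M0 rM Mmin sM]] := minimal_poly x A'hom.
  have [y ry] := closed_rootP _ (negbT (gtn_eqF sM)).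
  have rMxy : M.[(x, y)] = 0.
    by apply: injective_projections; rewrite ?horner_fst ?horner_snd ?rM /= ?(eqP ry).
  have ext := extension_partial_hom A'hom MA M0 rMxy Mmin.
  exists y; apply/prP; apply: (Amax (fun z => z \in extension A' x y)).
  + suff E : pr (fun z => z \in extension A' x y) = extension A' x y by rewrite /good E.
    by apply/funext => z; apply/prP/idP.
  + by move=> z /prP Az; apply: extension_sub.
  + exact: extension_gen.
by exists sigma => x y xyS; apply: sigmaP; apply/prP/SA.
Qed.

End PartialIso.

(** * Automorphisms of an algebraically closed field *)

Section Automorphisms.
Variable C : numClosedFieldType.

Definition is_aut (F : {pred C}) (sigma : {rmorphism C -> C}) : Prop :=
  (forall x, x \in F -> sigma x = x) /\
  exists2 tau : {rmorphism C -> C}, cancel sigma tau & cancel tau sigma.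

Lemma is_aut_id F : is_aut F (idfun : {rmorphism C -> C}).
Proof. by split=> //; exists (idfun : {rmorphism C -> C}). Qed.

Lemma is_aut_comp F (sigma tau : {rmorphism C -> C}) :
  is_aut F sigma -> is_aut F tau -> is_aut F (sigma \o tau).
Proof.
move=> [fs [s' sK s'K]] [ft [t' tK t'K]]; split=> [x xF|]; first by rewrite /= ft ?fs.
by exists (t' \o s' : {rmorphism C -> C}) => x /=; rewrite ?sK ?tK ?t'K ?s'K.
Qed.

Lemma is_aut_inv F (sigma : {rmorphism C -> C}) : is_aut F sigma ->
  exists tau, [/\ is_aut F tau, cancel sigma tau & cancel tau sigma].
Proof.
move=> [fs [tau sK tK]]; exists tau; split=> //; split; last by exists sigma.
by move=> x xF; rewrite -[in LHS](fs x xF) sK.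
Qed.

Lemma is_aut_sub (F G : {pred C}) sigma : {subset F <= G} -> is_aut G sigma -> is_aut F sigma.
Proof. by move=> FG [fs ?]; split=> // x /FG/fs. Qed.

Lemma fixes_horner (F : divringClosed C) (sigma : {rmorphism C -> C}) (p : {poly C}) x :
  (forall x, x \in F -> sigma x = x) -> p \is a polyOver F -> sigma p.[x] = p.[sigma x].
Proof.
move=> fs /polyOverP pF; rewrite -horner_map; congr (_.[_]).
by apply/polyP => i; rewrite coef_map /= fs.
Qed.

Lemma poly_roots (p : {poly C}) : p != 0 -> exists rs : seq C, forall x, root p x = (x \in rs).
Proof.
move=> p0; have [rs pE] := closed_field_poly_normal p; exists rs => x.
by rewrite pE rootZ ?lead_coef_eq0 // root_prod_XsubC.
Qed.

(** The injective [sigma] maps the finite root set of a polynomial over [F] into itself, hence onto,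
    and every element lies in such a set. *)
Lemma fixes_bij (F : divringClosed C) (sigma : {rmorphism C -> C}) :
  (forall x, alg F x) -> (forall x, x \in F -> sigma x = x) -> is_aut F sigma.
Proof.
move=> algF fs; split=> //.
have sinj : injective sigma by exact: fmorph_inj.
have surj y : exists x, sigma x = y.
  have [p [pF p0 ry]] := algF y; have [rs rsP] := poly_roots p0.
  have sub : {subset map sigma (undup rs) <= undup rs}.
    move=> _ /mapP[x xr ->]; rewrite mem_undup -rsP.
    by rewrite /root -(fixes_horner _ fs pF); move: xr; rewrite mem_undup -rsP => /eqP->; rewrite rmorph0.
  have [||_ E] := uniq_min_size _ sub.
  - by rewrite map_inj_uniq ?undup_uniq.
  - by rewrite size_map.
  have : y \in undup rs by rewrite mem_undup -rsP.
  by rewrite -E => /mapP[x _ ->]; exists x.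
have [tau tauK] := choice surj.
have tauK' : cancel sigma tau by move=> x; apply: sinj; rewrite tauK.
have tB : zmod_morphism tau by move=> x y; apply: sinj; rewrite rmorphB !tauK.
have tM : monoid_morphism tau.
  by split=> [|x y]; apply: sinj; rewrite ?rmorph1 ?rmorphM !tauK.
pose t : {rmorphism C -> C} := HB.pack tau (GRing.isZmodMorphism.Build C C tau tB)
  (GRing.isMonoidMorphism.Build C C tau tM).
by exists t.
Qed.

(** The identity of [K] is extended by sending [z] to a second root of its minimal polynomial, which
    has degree at least 2. *)
Lemma aut_moves_algebraic (K : divringClosed C) z : (forall x, alg K x) -> z \notin K ->
  exists2 sigma, is_aut K sigma & sigma z != z.
Proof.
move=> algK zK.
pose D : {pred C * C} := [pred xy | (xy.1 \in K) && (xy.1 == xy.2)].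
have Dhom0 : partial_hom K D := diag_partial_hom K.
have [Dcl _ _] := Dhom0.
pose D' : subringClosed (C * C)%type := HB.pack D
  (GRing.isSubringClosed.Build (C * C)%type D Dcl).
have Dhom : partial_hom K D' by exact: Dhom0.
have [M [MD M0 rM Mmin sM]] := minimal_poly algK z Dhom.
set p := map_poly snd M in sM.
have pE : map_poly fst M = p.
  apply/polyP => i; rewrite !coef_map /=.
  by have /andP[_ /eqP] := polyOverP MD i.
have pK : p \is a polyOver K.
  by apply/polyOverP => i; rewrite -pE coef_map /=; have /andP[] := polyOverP MD i.
rewrite pE in rM.
have p0 : p != 0 by apply: contraTneq sM => ->; rewrite size_poly0.
have pmin (q : {poly C}) : q \is a polyOver K -> q != 0 -> q.[z] = 0 -> (size p <= size q)%N.
  move=> /polyOverP qK q0 qz.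
  have cq i : (\poly_(i < size q) (q`_i, q`_i) : {poly C * C})`_i = (q`_i, q`_i).
    by rewrite coef_poly; case: ltnP => // /(nth_default 0) ->.
  have := Mmin (\poly_(i < size q) (q`_i, q`_i)).
  have -> : map_poly fst (\poly_(i < size q) (q`_i, q`_i)) = q.
    by apply/polyP => i; rewrite coef_map cq.
  rewrite size_map_poly_id0; last exact: (lead_snd algK Dhom MD M0).
  move=> h; apply: (leq_trans (h _ _ qz)); last exact: size_poly.
    by apply/polyOverP => i; rewrite cq inE /= qK eqxx.
  by apply: contraNneq q0 => E; apply/eqP/polyP => i; have := cq i; rewrite E !coef0 => -[].
have rp : root p z by apply/eqP.
have /factor_theorem[q pq] := rp.
have q0 : q != 0 by apply: contraNneq p0 => q0; rewrite pq q0 mul0r.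
have sp : size p = (size q).+1 by rewrite pq size_Mmonic ?monicXsubC // size_XsubC addn2.
have sq : (1 < size q)%N.
  rewrite ltnNge; apply/negP => sq; case/negP: zK.
  have sp2 : (size p <= 2)%N by rewrite sp.
  have p1 : p`_1 != 0.
    apply/negP => /eqP p1; have : (size p <= 1)%N.
      by apply/leq_sizeP => -[|[|j]] // _; apply: (leq_sizeP _ _ sp2).
    by rewrite leqNgt sM.
  have -> : z = - p`_0 / p`_1.
    apply: (mulIf p1); rewrite divfK //; apply/eqP; rewrite -subr_eq0 opprK addrC.
    move: rM; rewrite (horner_coef_wide _ sp2) !big_ord_recl big_ord0 /= addr0.
    by rewrite mulr1 expr1 mulrC => ->.
  by rewrite rpred_div ?rpredN //; apply: (polyOverP pK).
(* Separability: otherwise the derivative, nonzero in characteristic 0 and of smaller size, would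
   vanish at [z]. *)
have qz : q.[z] != 0.
  apply/negP => /eqP qz; have dz : p^`().[z] = 0.
    by rewrite pq derivM !hornerE qz derivXsubC !hornerE subrr !mulr0 ?add0r ?addr0 ?mul0r.
  have d0 : p^`() != 0.
    apply/eqP => /(congr1 (coefp (size q).-1)); rewrite /= coef0 coef_deriv.
    rewrite prednK ?(ltnW sq) // => /eqP; rewrite mulrn_eq0 -[size q]/(size q).+1.-1 -sp.
    by rewrite -lead_coefE lead_coef_eq0 (negPf p0) orbF sp; case: (size q) sq.
  have := pmin _ (polyOver_deriv pK) d0 dz; rewrite leqNgt.
  by rewrite lt_size_deriv.
have [z' rz'] := closed_rootP q (negbT (gtn_eqF sq)).
have z'z : z' != z by apply: contraNneq qz => <-.
have rM' : M.[(z, z')] = 0.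
  apply: injective_projections; rewrite ?horner_fst ?horner_snd /= ?pE //.
  by rewrite -/p pq hornerM (eqP rz') mul0r.
have ext := extension_partial_hom algK Dhom MD M0 rM' Mmin.
have [ecl _ _] := ext.
pose E' : subringClosed (C * C)%type := HB.pack (extension D' z z')
  (GRing.isSubringClosed.Build (C * C)%type (extension D' z z') ecl).
have Ehom : partial_hom K E' by exact: ext.
have [s sP] := embedding_extends algK Ehom.
exists s; last by rewrite (sP z z') //; apply: extension_gen.
apply: fixes_bij => // x xK; apply: sP; have [_ EK _] := Ehom.
exact: EK.
Qed.

Lemma aut_moves (k : divringClosed C) z : alg k z -> z \notin k ->
  exists2 sigma, is_aut k sigma & sigma z != z.
Proof.
move=> az zk; have [K [kK zK algK]] := avoiding_subfield zk az.
have [s sa sz] := aut_moves_algebraic algK zK.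
by exists s => //; apply: is_aut_sub sa.
Qed.

Lemma fixed_mem (k : divringClosed C) z : alg k z ->
  (forall sigma, is_aut k sigma -> sigma z = z) -> z \in k.
Proof.
move=> az fz; apply: contrapT => /negP /(aut_moves az)[s /fz ->].
by rewrite eqxx.
Qed.

End Automorphisms.

(** * Finitely generated fields, conjugates and norms *)

Section Generated.
Variable C : numClosedFieldType.

Definition gen (s : seq C) : {pred C} :=
  fun x => `[< forall S : divringClosed C, {subset s <= S} -> x \in S >].

Lemma genP s x : reflect (forall S : divringClosed C, {subset s <= S} -> x \in S) (x \in gen s).
Proof. exact: asboolP. Qed.

Lemma gen_closed s : divring_closed (gen s).
Proof.
split=> [|x y /genP xs /genP ys|x y /genP xs /genP ys]; apply/genP => S sS.
- exact: rpred1.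
- by rewrite rpredB ?xs ?ys.
- by rewrite rpred_div ?xs ?ys.
Qed.
HB.instance Definition _ s := GRing.isDivringClosed.Build C (gen s) (gen_closed s).

Lemma mem_gen s : {subset s <= gen s}.
Proof. by move=> x xs; apply/genP => S; apply. Qed.

Lemma gen_sub s (S : divringClosed C) : {subset s <= S} -> {subset gen s <= S}.
Proof. by move=> sS x /genP; apply. Qed.

Lemma eq_on_gen s (sigma tau : {rmorphism C -> C}) :
  map sigma s = map tau s -> {in gen s, sigma =1 tau}.
Proof.
move=> /eq_in_map st x /genP xs.
have cl : divring_closed [pred x | sigma x == tau x].
  split=> [|y z|y z]; rewrite !inE ?rmorph1 // => /eqP yE /eqP zE.
    by rewrite !rmorphB yE zE.
  by rewrite !fmorph_div yE zE.
by apply/eqP; apply: (xs (divring_of cl)) => y /st E; rewrite inE E.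
Qed.

Lemma is_aut_gen s (sigma : {rmorphism C -> C}) (F : {pred C}) : is_aut F sigma ->
  (forall x, x \in s -> sigma x = x) -> is_aut (gen s) sigma.
Proof.
move=> [_ inv] fs; split=> // x xs; rewrite (@eq_on_gen s sigma idfun) //.
by apply/eq_in_map => y /fs.
Qed.

Section Conjugates.
Variables (F : divringClosed C) (s : seq C).
Hypothesis algF : forall x, alg F x.

Lemma finitely_many_images : exists L : seq (seq C),
  forall sigma, is_aut F sigma -> map sigma s \in L.
Proof.
elim: s => [|x s' [L LP]]; first by exists [:: [::]].
have [p [pF p0 rx]] := algF x; have [rs rsP] := poly_roots p0.
exists [seq y :: l | y <- rs, l <- L] => sigma sa /=.
apply/allpairsP; exists (sigma x, map sigma s'); split; [|exact: LP|by []].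
by rewrite /= -rsP /root -(fixes_horner _ sa.1 pF) (eqP rx) rmorph0.
Qed.

(** The [rho i] represent the distinct restrictions to [gen s] of automorphisms over [F], finite in
    number because each generator has finitely many conjugates. Norms and characteristic polynomials
    are products over them. *)
Lemma finitely_many_restrictions : exists (n : nat) (rho : 'I_n -> {rmorphism C -> C}),
  [/\ forall i, is_aut F (rho i),
      forall sigma, is_aut F sigma -> exists i, {in gen s, sigma =1 rho i} &
      forall i j, {in gen s, rho i =1 rho j} -> i = j].
Proof.
have [L LP] := finitely_many_images.
pose L' := undup [seq l <- L | `[< exists2 sigma, is_aut F sigma & map sigma s = l >]].
have rhoP (i : 'I_(size L')) : exists sigma : {rmorphism C -> C},
    is_aut F sigma /\ map sigma s = nth [::] L' i.
  have : nth [::] L' i \in L' by rewrite mem_nth.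
  by rewrite mem_undup mem_filter => /andP[/asboolP[sigma sa sE] _]; exists sigma.
have [rho {}rhoP] := choice rhoP.
exists (size L'), rho; split=> [i|sigma sa|i j ij]; first exact: (rhoP i).1.
  have sL : map sigma s \in L'.
    by rewrite mem_undup mem_filter LP // andbT; apply/asboolP; exists sigma.
  have lt : (index (map sigma s) L' < size L')%N by rewrite index_mem.
  exists (Ordinal lt); apply: eq_on_gen.
  by rewrite (rhoP (Ordinal lt)).2 /= nth_index.
apply/ord_inj/eqP; rewrite -(@nth_uniq _ [::] L') ?undup_uniq //.
rewrite -(rhoP i).2 -(rhoP j).2; apply/eqP/eq_in_map => x xs.
by apply/ij/mem_gen.
Qed.

Variables (n : nat) (rho : 'I_n -> {rmorphism C -> C}).
Hypotheses (rho_aut : forall i, is_aut F (rho i))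
  (rho_all : forall sigma, is_aut F sigma -> exists i, {in gen s, sigma =1 rho i})
  (rho_inj : forall i j, {in gen s, rho i =1 rho j} -> i = j).

Lemma rho_permuted sigma : is_aut F sigma ->
  exists2 pi : 'I_n -> 'I_n, injective pi & forall i, {in gen s, sigma \o rho i =1 rho (pi i)}.
Proof.
move=> sa; have h i : exists j, {in gen s, sigma \o rho i =1 rho j}.
  exact: (rho_all (is_aut_comp sa (rho_aut i))).
have [pi piP] := choice h; exists pi => // i j ij; apply: rho_inj => x xs.
apply: (fmorph_inj sigma); have /= -> := piP i x xs.
by have /= -> := piP j x xs; rewrite ij.
Qed.

(** Composition with an automorphism over [F] permutes the restrictions [rho i], so the coefficients
    are fixed and [fixed_mem] applies. *)
Lemma charpoly_over x : x \in gen s -> \prod_i ('X - (rho i x)%:P) \is a polyOver F.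
Proof.
move=> xs; apply/polyOverP => k; apply: fixed_mem => // sigma sa.
have [pi pi_inj piP] := rho_permuted sa.
have -> : sigma (\prod_i ('X - (rho i x)%:P))`_k =
   (map_poly sigma (\prod_i ('X - (rho i x)%:P)))`_k by rewrite coef_map.
transitivity ((\prod_i ('X - (rho (pi i) x)%:P))`_k).
  rewrite rmorph_prod /=; congr ((polyseq _)`_k); apply: eq_bigr => i _.
  by rewrite rmorphB /= map_polyX map_polyC /=; have /= -> := piP i x xs.
by rewrite [in RHS](reindex_inj pi_inj).
Qed.

Lemma norm_mem x : x \in gen s -> \prod_i rho i x \in F.
Proof.
move=> xs; apply: fixed_mem => // sigma sa.
have [pi pi_inj piP] := rho_permuted sa.
rewrite rmorph_prod [RHS](reindex_inj pi_inj) /=.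
by apply: eq_bigr => i _; have /= -> := piP i x xs.
Qed.

End Conjugates.
End Generated.

(** * Galois action on roots of unity *)

Section Cyclotomic.
Variable C : numClosedFieldType.

Definition rational : {pred C} := fun x => `[< exists r : rat, x = ratr r >].

Lemma rationalP x : reflect (exists r : rat, x = ratr r) (x \in rational).
Proof. exact: asboolP. Qed.

Lemma rational_closed : divring_closed rational.
Proof.
split=> [|_ _ /rationalP[a ->] /rationalP[b ->]|_ _ /rationalP[a ->] /rationalP[b ->]];
  apply/rationalP.
- by exists 1; rewrite rmorph1.
- by exists (a - b); rewrite rmorphB.
- by exists (a / b); rewrite fmorph_div.
Qed.
HB.instance Definition _ := GRing.isDivringClosed.Build C rational rational_closed.

Lemma polyOver_rational (p : {poly C}) : p \is a polyOver rational ->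
  exists q : {poly rat}, p = map_poly ratr q.
Proof.
move=> /polyOverP pQ; have [f fP] := choice (fun i => elimT (rationalP _) (pQ i)).
exists (\poly_(i < size p) f i); apply/polyP => i; rewrite coef_map coef_poly /= fP.
by case: ltnP => // /(nth_default 0); rewrite fP => ->; rewrite rmorph0.
Qed.

Lemma prim_root_Cyclotomic n (z : C) : n.-primitive_root z -> 
  root (map_poly intr 'Phi_n) z.
Proof.
move=> pz; have n0 := prim_order_gt0 pz.
have : root (map_poly intr (\prod_(d <- divisors n) 'Phi_d)) z.
  rewrite prod_Cyclotomic // rmorphB rmorph1 /= map_polyXn /root !hornerE.
  by rewrite prim_expr_order // subrr.
rewrite rmorph_prod /root horner_prod prodf_seq_eq0 => /hasP[d].
rewrite -dvdn_divisors // => dn; case: (ltngtP d n) => [lt|gt|->] //; last first.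
  by move: gt; rewrite ltnNge dvdn_leq.
have d0 := dvdn_gt0 n0 dn.
rewrite /= => rd; suff : root ('X^d - 1) z.
  rewrite /root !hornerE subr_eq0 => /eqP zd.
  have /(dvdn_leq d0) : (n %| d)%N by rewrite (prim_order_dvd pz) zd.
  by rewrite leqNgt lt.
have -> : 'X^d - 1 = map_poly intr (\prod_(d <- divisors d) 'Phi_d) :> {poly C}.
  by rewrite prod_Cyclotomic // rmorphB rmorph1 /= map_polyXn.
rewrite (big_rem d) /=; last by rewrite -dvdn_divisors.
by rewrite rmorphM /root hornerM mulf_eq0 rd.
Qed.

(** Irreducibility of the cyclotomic polynomial is carried over from [algC]: its gcd with [q] is
    rational and nonconstant, so it has a root in [algC], a primitive n-th root with the cyclotomic
    polynomial as minimal polynomial, which therefore divides [q]. *)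
Lemma conjugate_prim_root (q : {poly rat}) n (z : C) s : n.-primitive_root z ->
  coprime s n -> root (map_poly ratr q) z -> root (map_poly ratr q) (z ^+ s).
Proof.
move=> pz sn rq; have n0 := prim_order_gt0 pz.
have [y py] := C_prim_root_exists n0.
have [p [yp p_monic pP]] := minCpolyP y.
have pE : p = map_poly intr 'Phi_n.
  apply: (map_poly_inj (ratr : rat -> algC)); rewrite -yp (minCpoly_cyclotomic py).
  rewrite -(Cintr_Cyclotomic py) -map_poly_comp.
  by apply: eq_map_poly => x /=; rewrite rmorph_int.
have pC : map_poly (ratr : rat -> C) p = map_poly intr 'Phi_n.
  by rewrite pE -map_poly_comp; apply: eq_map_poly => x /=; rewrite rmorph_int.
have rp (w : C) : n.-primitive_root w -> root (map_poly ratr p) w.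
  by move=> pw; rewrite pC prim_root_Cyclotomic.
suff /dvdpP[q' ->] : p %| q.
  rewrite rmorphM rootM; apply/orP; right; apply: rp.
  by rewrite prim_root_exp_coprime.
suff : p %| gcdp p q by rewrite dvdp_gcd => /andP[].
have rg : root (map_poly ratr (gcdp p q)) z.
  by rewrite gcdp_map root_gcd; apply/andP; split=> //; apply: rp.
have sg : (1 < size (gcdp p q))%N.
  rewrite -(size_map_poly (ratr : {rmorphism rat -> C})).
  apply: root_size_gt1 rg; rewrite map_poly_eq0 gcdp_eq0 negb_and.
  by rewrite monic_neq0.
have [|x rx] := closed_rootP (map_poly (ratr : rat -> algC) (gcdp p q)) _.
  by rewrite size_map_poly (gtn_eqF sg).
have px : n.-primitive_root x.
  rewrite -(root_cyclotomic py) -(minCpoly_cyclotomic py) yp.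
  by move: rx; rewrite gcdp_map root_gcd => /andP[].
have [p' [xp' _ p'P]] := minCpolyP x.
have e : minCpoly y = minCpoly x.
  by rewrite (minCpoly_cyclotomic py) (minCpoly_cyclotomic px)
             -(Cintr_Cyclotomic py) -(Cintr_Cyclotomic px).
rewrite yp xp' in e.
by rewrite {1}(map_poly_inj _ e) -p'P.
Qed.

Section OpenImage.
Variable F : divringClosed C.
Hypotheses (algF : forall x, alg F x)
  (ratF : forall x, x \in F -> alg rational x -> x \in rational).

(** The characteristic polynomial of [z] has coefficients in [F] that are algebraic over the
    rationals, hence rational; so [z ^+ s] is one of its roots [rho i z]. *)
Lemma aut_prim_root n (z : C) s : n.-primitive_root z -> coprime s n ->
  exists2 sigma, is_aut F sigma & sigma z = z ^+ s.
Proof.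
move=> pz sn; have n0 := prim_order_gt0 pz.
have [m [rho [rho_aut rho_all rho_inj]]] := finitely_many_restrictions [:: z] algF.
have zs : z \in gen [:: z] by apply: mem_gen; rewrite mem_seq1.
have /polyOverP pF := charpoly_over algF rho_aut rho_all rho_inj zs.
have az i : rho i z \in alg_closure rational.
  apply/alg_closureP; exists ('X^n - 1); split.
  - by rewrite rpredB ?rpred1 ?polyOverXn.
  - by rewrite -size_poly_eq0 size_XnsubC.
  - rewrite /root !hornerE -rmorphXn prim_expr_order // rmorph1 subrr //.
have [q qE] : exists q : {poly rat}, \prod_i ('X - (rho i z)%:P) = map_poly ratr q.
  apply/polyOver_rational/polyOverP => k; apply: ratF => //; apply/alg_closureP.
  by apply/polyOverP; apply: rpred_prod => i _; rewrite polyOverXsubC az.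
have : root (map_poly ratr q) (z ^+ s).
  apply: conjugate_prim_root (pz) sn _; rewrite -qE.
  have [i /(_ _ zs) /= zi] := rho_all _ (is_aut_id F).
  rewrite /root horner_prod (bigD1 i) //= !hornerE -zi subrr.
  by rewrite mul0r.
rewrite -qE /root horner_prod => /eqP/eqP; rewrite prodf_seq_eq0 => /hasP[i _ /=].
rewrite !hornerE subr_eq0 => /eqP ->.
by exists (rho i).
Qed.

(* Aut(C/F) is a finite union of cosets of Aut(C/F(s)); a coset that misses some
   congruence subgroup is excluded by the choice of M0. *)
Lemma open_image s : exists2 M0 : nat, (0 < M0)%N & forall n sigma, (0 < n)%N -> is_aut F sigma ->
    (forall z, z ^+ M0 = 1 -> sigma z = z) ->
  exists2 tau, is_aut (gen s) tau & forall z, z ^+ n = 1 -> tau z = sigma z.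
Proof.
have [m [rho [rho_aut rho_all rho_inj]]] := finitely_many_restrictions s algF.
pose fixmu n (sigma : {rmorphism C -> C}) := forall z, z ^+ n = 1 -> sigma z = z.
pose meets i n := exists sigma, [/\ is_aut F sigma, {in gen s, sigma =1 rho i} & fixmu n sigma].
have h i : exists n, (0 < n)%N /\ (~ meets i n \/ forall k, (0 < k)%N -> meets i k).
  have [[n [n0 mn]]|nex] := pselect (exists n, (0 < n)%N /\ ~ meets i n).
    by exists n; split=> //; left.
  exists 1%N; split=> //; right => k k0; apply: contrapT => mk; apply: nex.
  by exists k.
have [N NP] := choice h.
exists (\prod_i N i)%N; first by apply: prodn_gt0 => i; case: (NP i).
move=> n sigma n0 sa sM.
have [i si] := rho_all _ sa.
have {h} meetsi : forall k, (0 < k)%N -> meets i k.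
  case: (NP i) => _ [[]|//]; exists sigma; split=> // z zN; apply: sM.
  by rewrite (bigD1 i) //= exprM zN expr1n.
have [tau [ta ti tn]] := meetsi n n0.
have [tau' [ta' tK t'K]] := is_aut_inv ta.
(* [tau] agrees with [sigma] on [gen s] and fixes the n-th roots of unity, so its inverse corrects
   [sigma] without changing the action on these roots. *)
exists (tau' \o sigma : {rmorphism C -> C}).
  apply: (is_aut_gen (is_aut_comp ta' sa)) => x xs /=.
  by rewrite si ?mem_gen // -ti ?mem_gen // tK.
move=> z zn /=; have szn : sigma z ^+ n = 1 by rewrite -rmorphXn zn rmorph1.
by rewrite -[in LHS](tn _ szn) tK.
Qed.

End OpenImage.
End Cyclotomic.

(** * Homomorphisms from a finitely generated field to the integers *)

Section Valuation.
Variable C : numClosedFieldType.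

Lemma transcendental_horner (K : divringClosed C) g (p : {poly C}) : ~ alg K g ->
  p \is a polyOver K -> p != 0 -> p.[g] != 0.
Proof. by move=> ng pK p0; apply/negP => pg; apply: ng; exists p. Qed.

(** As [g] is transcendental, equal quotients have equal cross products as polynomials, so the order
    is independent of the representation. Elements without one get the value 0. *)
Lemma order_at_transcendental (K : divringClosed C) g : ~ alg K g ->
  exists ord : C -> int, forall f h : {poly C}, f \is a polyOver K -> h \is a polyOver K ->
    f != 0 -> h != 0 -> ord (f.[g] / h.[g]) = (mup 0 f)%:Z - (mup 0 h)%:Z.
Proof.
move=> ng; have eval := transcendental_horner ng.
suff /choice[ord ordP] : forall y, exists z : int, forall f h : {poly C},
    f \is a polyOver K -> h \is a polyOver K -> f != 0 -> h != 0 -> y = f.[g] / h.[g] ->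
    z = (mup 0 f)%:Z - (mup 0 h)%:Z.
  by exists ord => f h fK hK f0 h0; apply: ordP.
move=> y; have [[f [h [fK hK f0 h0 yE]]]|nex] := pselect (exists f h : {poly C},
   [/\ f \is a polyOver K, h \is a polyOver K, f != 0, h != 0 & y = f.[g] / h.[g]]); last first.
  by exists 0 => f h fK hK f0 h0 yE; case: nex; exists f, h.
exists ((mup 0 f)%:Z - (mup 0 h)%:Z) => f' h' fK' hK' f0' h0'; rewrite yE => /eqP.
rewrite eqr_div ?eval // -!hornerM -subr_eq0 -hornerN -hornerD => E.
have {}E : f * h' = f' * h.
  apply/eqP; rewrite -subr_eq0; apply: contraTT E => /eval; apply.
  by rewrite rpredB ?rpredM.
have := congr1 (mup 0) E; rewrite !mupM //; lia.
Qed.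

(* v is the order at g of the norm down to K(g), where K is maximal with g
   transcendental over K. *)
Lemma integral_character s g : g \in gen s -> ~ alg (@rational C) g ->
  exists2 v : C -> int, v g != 0 & forall x y, x \in gen s -> y \in gen s ->
    x != 0 -> y != 0 -> v (x * y) = v x + v y.
Proof.
move=> gs /transcendental_subfield[K [_ ng algKg]].
have [n [rho [rho_aut rho_all rho_inj]]] := finitely_many_restrictions s algKg.
have [ord ordP] := order_at_transcendental ng.
have eval := transcendental_horner ng.
pose N x := \prod_i rho i x.
have NP x : x \in gen s -> x != 0 -> exists f h : {poly C},
   [/\ f \is a polyOver K, h \is a polyOver K, f != 0, h != 0 & N x = f.[g] / h.[g]].
  move=> xs x0; have /adjoinP[f [h [fK hK hg NE]]] := norm_mem algKg rho_aut rho_all rho_inj xs.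
  exists f, h; split=> //; last by apply: contraNneq hg => ->; rewrite horner0.
  have : N x != 0 by rewrite prodf_seq_neq0; apply/allP => i _; rewrite fmorph_eq0.
  by rewrite /N NE; apply: contraNneq => ->; rewrite horner0 mul0r.
exists (ord \o N) => [|x y xs ys x0 y0] /=.
  (* All [rho i] fix [g], so its norm is g^n, of order n; and n > 0 because the identity restricts
     to some [rho i]. *)
  have -> : N g = (('X - 0%:P : {poly C}) ^+ n).[g] / (1 : {poly C}).[g].
    rewrite subr0 hornerXn hornerC divr1 /N (eq_bigr (fun _ => g)).
      by rewrite prodr_const card_ord.
    by move=> i _; apply: (rho_aut i).1; exact: adjoin_gen.
  rewrite ordP ?rpredX ?rpred1 ?oner_eq0 ?polyOverXsubC ?rpred0 //; last first.
    by rewrite expf_neq0 // polyXsubC_eq0.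
  rewrite mup_XsubCX eqxx mupNroot ?root1 // subr0.
  have [i _] := rho_all _ (is_aut_id _).
  by case: {+}n i => [[]|].
have [f [h [fK hK f0 h0 NxE]]] := NP x xs x0.
have [f' [h' [fK' hK' f0' h0' NyE]]] := NP y ys y0.
have -> : N (x * y) = (f * f').[g] / (h * h').[g].
  rewrite !hornerM -mulf_div -NxE -NyE /N -big_split /=.
  by apply: eq_bigr => i _; rewrite rmorphM.
rewrite NxE NyE !ordP ?rpredM ?mulf_neq0 // !mupM //; lia.
Qed.

End Valuation.

(** * Finiteness of algebraic numbers of bounded size *)

Section Northcott.
Variable C : numClosedFieldType.

Notation integral := (integralOver (intr : int -> C)).

Lemma rational_integral x : x \in @rational C -> integral x -> exists z : int, x = z%:~R.
Proof.
move=> /rationalP[r ->] [p p_monic rp].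
have rp' : root (map_poly intr p) r.
  rewrite -(fmorph_root (ratr : {rmorphism rat -> C})) -map_poly_comp.
  by rewrite (eq_map_poly (g := intr)) // => z /=; rewrite rmorph_int.
have : (ratr r : algC) \in Num.int.
  apply: Cint_rat_Aint; first exact: Crat_rat.
  apply: (@root_monic_Aint (map_poly intr p)); last first.
  - by apply/polyOverP => i; rewrite coef_map /= rpred_int_num.
  - by rewrite monic_map.
  - move: rp'; rewrite -(fmorph_root (ratr : {rmorphism rat -> algC})) -map_poly_comp.
    by rewrite (eq_map_poly (g := intr)) // => z /=; rewrite rmorph_int.
move=> /intrP[z zE]; exists z.
have -> : r = z%:~R by apply: (fmorph_inj (ratr : {rmorphism rat -> algC})); rewrite rmorph_int; exact: zE.
by rewrite rmorph_int.
Qed.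

Lemma alg_rational_int x : alg (@rational C) x ->
  exists2 p : {poly int}, p != 0 & root (map_poly intr p) x.
Proof.
move=> [_ [/polyOver_rational[q ->] q0 rq]].
have [p [a a0 qE]] := rat_poly_scale q.
exists p.
  apply: contraNneq q0 => p0; rewrite qE p0 rmorph0 scaler0 rmorph0 //.
move: rq; rewrite qE linearZ /= rootZ; last first.
  by rewrite fmorph_eq0 invr_eq0 intr_eq0.
rewrite -map_poly_comp (eq_map_poly (g := intr)) // => z /=; by rewrite rmorph_int.
Qed.

Lemma integral_multiple x : alg (@rational C) x ->
  exists2 a : int, a != 0 & integral (a%:~R * x).
Proof.
move=> /alg_rational_int[p p0 /eqP rp].
have [sp|sp] := leqP (size p) 1.
  exfalso; move: rp p0; rewrite (size1_polyC sp) map_polyC hornerC polyC_eq0 /=.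
  by move/eqP; rewrite intr_eq0 => ->.
set n := (size p).-2; have sn : size p = n.+2 by rewrite /n; case: (size p) sp => [|[]].
set a := lead_coef p; exists a; first by rewrite lead_coef_eq0.
(* This is a^n p(X/a), monic of degree n + 1, with root a x. *)
pose q : {poly int} := \poly_(i < n.+2) (if i == n.+1 then 1 else p`_i * a ^+ (n - i)).
have sq : size q = n.+2 by rewrite size_poly_eq // eqxx.
exists q; first by rewrite monicE lead_coefE sq coef_poly ltnSn eqxx.
apply/eqP; rewrite (_ : (map_poly intr q) = 
  \poly_(i < n.+2) (if i == n.+1 then 1 else (p`_i * a ^+ (n - i))%:~R)); last first.
  by apply/polyP => i; rewrite coef_map !coef_poly; case: ifP => // _ /=; case: ifP.
rewrite horner_poly; transitivity (a%:~R ^+ n * (map_poly intr p).[x]); last first.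
  by rewrite rp mulr0.
rewrite (@horner_coef_wide _ n.+2); last by rewrite -sn size_poly.
rewrite mulr_sumr; apply: eq_bigr => i _; rewrite coef_map /=.
case: eqP => [->|ni].
  by rewrite -[n.+1]/(n.+2.-1) -sn -lead_coefE -/a mul1r sn exprMn exprS; ring.
have le : (i <= n)%N by have := ltn_ord i; lia.
have -> : (a%:~R : C) ^+ n = a%:~R ^+ (n - i) * a%:~R ^+ i by rewrite -exprD subnK.
rewrite exprMn intrM rmorphXn /=; ring.
Qed.

Lemma common_integral_multiple m (b : 'I_m -> C) : (forall i, alg (@rational C) (b i)) ->
  exists2 a : int, a != 0 & forall i, integral (a%:~R * b i).
Proof.
move=> balg; have /choice[a aP] : forall i, exists a : int, a != 0 /\ integral (a%:~R * b i).
  by move=> i; have [a a0 ai] := integral_multiple (balg i); exists a.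
exists (\prod_i a i) => [|i]; first by apply/prodf_neq0 => i _; case: (aP i).
rewrite (bigD1 i) //= mulrC intrM mulrA mulrC.
by apply: integral_mul; [exact: integral_id | rewrite mulrC; case: (aP i)].
Qed.

Lemma integral_exp x n : integral x -> integral (x ^+ n).
Proof.
by move=> xi; elim: n => [|n IHn]; rewrite ?expr0 ?exprS; [exact: integral1 | exact: integral_mul].
Qed.

Lemma integral_root_exp x n : (0 < n)%N -> integral (x ^+ n) -> integral x.
Proof.
move=> n0 xi; apply: (@integral_root_monic _ _ _ _ ('X^n - (x ^+ n)%:P)).
- exact: monicXnsubC.
- by rewrite /root !hornerE subrr.
- apply/integral_poly => i; rewrite coefB coefXn coefC; apply: integral_sub.
    exact: integral_nat.
  by case: ifP => // _; exact: integral0.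
Qed.

Lemma integral_morph (sigma : {rmorphism C -> C}) x : integral x -> integral (sigma x).
Proof.
move=> [p p_monic rp]; exists p => //.
rewrite -(fmorph_root sigma) -map_poly_comp in rp.
by rewrite (eq_map_poly (g := intr)) in rp => // z /=; rewrite rmorph_int.
Qed.

Lemma prod_XsubC_bound d (a : 'I_d -> C) (A : C) : 0 <= A -> (forall i, `|a i| <= A) ->
  forall k, `|(\prod_i ('X - (a i)%:P))`_k| <= (1 + A) ^+ d.
Proof.
move=> A0 aA; elim: d a aA => [|d IHd] a aA k.
  by rewrite big_ord0 coef1 expr0; case: eqP => _; rewrite ?normr1 ?normr0.
rewrite big_ord_recl mulrBl coefB coefXM coefCM exprS mulrDl mul1r.
apply: (le_trans (ler_normB _ _)); apply: lerD.
  case: eqP => _; first by rewrite normr0 exprn_ge0 // addr_ge0.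
  by apply: (IHd (fun i => a (lift ord0 i))) => i.
rewrite normrM; apply: ler_pM => //.
by apply: (IHd (fun i => a (lift ord0 i))) => i.
Qed.

Lemma integral_coef_prod d (a : 'I_d -> C) : (forall i, integral (a i)) ->
  forall k, integral (\prod_i ('X - (a i)%:P))`_k.
Proof.
move=> ai; apply: (big_ind (fun p : {poly C} => forall k, integral p`_k)) => [k|p q pi qi k|i _ k].
- by rewrite coef1; apply: integral_nat.
- rewrite coefM; apply: big_ind => [||i _]; [exact: integral0 | exact: integral_add | ].
  exact: integral_mul.
- rewrite coefB coefX coefC; apply: integral_sub; first exact: integral_nat.
  by case: ifP => _ //; exact: integral0.
Qed.

Lemma integral_alg x : integral x -> alg (@rational C) x.
Proof.
move=> [p p_monic rp]; exists (map_poly intr p); split=> //.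
  by apply/polyOverP => i; rewrite coef_map rpred_int.
by rewrite monic_neq0 // monic_map.
Qed.

Hypothesis arch : forall x : C, exists n : nat, `|x| <= n%:R.

Lemma common_bound (I : finType) (a : I -> C) : exists n : nat, forall i, `|a i| <= n%:R.
Proof.
have [f fP] := choice (fun i => arch (a i)).
exists (\sum_i f i)%N => i; apply: (le_trans (fP i)).
by rewrite ler_nat (bigD1 i) //= leq_addr.
Qed.

Lemma finite_int_polys d (H : nat) : exists L : seq C,
  forall (p : {poly C}) x, p != 0 -> (size p <= d)%N ->
    (forall i, exists2 z : int, p`_i = z%:~R & `|p`_i| <= H%:R) -> root p x -> x \in L.
Proof.
pose P (f : {ffun 'I_d -> 'I_(H + H).+1}) : {poly C} :=
  \poly_(i < d) (if insub i is Some j then ((f j)%:Z - H%:Z)%:~R else 0).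
have /choice[rs rsP] : forall f, exists rs : seq C,
    P f != 0 -> forall x, root (P f) x -> x \in rs.
  move=> f; have [P0|P0] := eqVneq (P f) 0; first by exists [::] => /eqP.
  by have [rs rsP] := poly_roots P0; exists rs => _ x; rewrite rsP.
exists (flatten [seq rs f | f <- enum {ffun 'I_d -> 'I_(H + H).+1}]) => p x p0 sp pz rx.
have /choice[z zP] : forall i, exists z : int, p`_i = z%:~R /\ `|z| <= H%:Z.
  move=> i; have [z zE zH] := pz i; exists z; split=> //.
  by move: zH; rewrite zE -intr_norm -[H%:R]/(H%:~R) ler_int.
pose f : {ffun 'I_d -> 'I_(H + H).+1} := [ffun i : 'I_d => inord (absz (z i + H%:Z))].
have Pf : P f = p.
  apply/polyP => i; rewrite coef_poly; case: ltnP => [id|/(leq_trans sp) ps]; last first.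
    by rewrite nth_default.
  have [zE zH] := zP i; rewrite insubT ffunE /= inordK; last by lia.
  by rewrite zE; congr (_%:~R); lia.
apply/flatten_mapP; exists f; first by rewrite mem_enum.
by apply: rsP; rewrite Pf.
Qed.

(** [c] behaves like a product of powers of the [b i] with exponents n_i/M in [0, 1]. So a^m c is
    integral with conjugates bounded by [A], independently of M and the n_i, and its characteristic
    polynomial is one of finitely many integer polynomials. *)
Lemma northcott s m (b : 'I_m -> C) : (forall i, b i \in gen s) ->
    (forall i, alg (@rational C) (b i)) ->
  exists L : seq C, forall c M (n : 'I_m -> nat), c \in gen s -> (0 < M)%N ->
    (forall i, (n i <= M)%N) -> c ^+ M = \prod_i b i ^+ n i -> c \in L.
Proof.
move=> bs balg.
have [F [ratF Frat algF]] := relatively_closed_subfield (@rational C).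
have [d [rho [rho_aut rho_all rho_inj]]] := finitely_many_restrictions s algF.
have [a a0 aP] := common_integral_multiple balg.
pose bb (x : option ('I_d * 'I_m)) : C :=
  if x is Some (j, i) then a%:~R * rho j (b i) else a%:~R.
have [B BP] := common_bound bb.
pose A : C := B%:R ^+ m.
have [H HP] := arch ((1 + A) ^+ d).
have [L LP] := finite_int_polys d.+1 H.
have aC : (a%:~R : C) != 0 by rewrite intr_eq0.
exists [seq y / a%:~R ^+ m | y <- L] => c M n cs M0 nM cM.
pose c' := a%:~R ^+ m * c.
apply/mapP; exists c'; last by rewrite /c' mulrAC divff ?mul1r // expf_neq0.
(* Since n_i <= M, only nonnegative powers of the integral elements a and a b_i occur. *)
have c'M : c' ^+ M = \prod_i (a%:~R ^+ (M - n i) * (a%:~R * b i) ^+ n i).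
  transitivity (\prod_i (a%:~R ^+ M * b i ^+ n i)); last first.
    by apply: eq_bigr => i _; rewrite exprMn mulrA -exprD subnK.
  by rewrite /c' exprMn cM big_split /= prodr_const card_ord exprAC.
have c's : c' \in gen s by rewrite rpredM ?rpredX // rpred_int.
have rhoc j : rho j c' ^+ M = \prod_i (a%:~R ^+ (M - n i) * (a%:~R * rho j (b i)) ^+ n i).
  rewrite -rmorphXn c'M rmorph_prod; apply: eq_bigr => i _.
  by rewrite /= rmorphM !rmorphXn rmorphM !rmorph_int.
have c'int j : integralOver (intr : int -> C) (rho j c').
  apply: integral_morph; apply: (integral_root_exp M0); rewrite c'M.
  apply: big_ind => [||i _]; [exact: integral1 | exact: integral_mul | ].
  by apply: integral_mul; apply: integral_exp => //; exact: integral_id.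
have rhoA j : `|rho j c'| <= A.
  rewrite -(ler_pXn2r M0) ?nnegrE ?exprn_ge0 //.
  rewrite -normrX rhoc normr_prod /A exprAC -[m in X in _ <= X]card_ord -prodr_const.
  apply: ler_prod => i _; rewrite normr_ge0 /= normrM !normrX -[in leRHS](subnK (nM i)) exprD.
  apply: ler_pM; rewrite ?exprn_ge0 //; apply: lerXn2r; rewrite ?nnegrE //.
    exact: (BP None).
  exact: (BP (Some (j, i))).
pose p := \prod_i ('X - (rho i c')%:P).
have pF := charpoly_over algF rho_aut rho_all rho_inj c's.
apply: (LP p).
- by rewrite monic_neq0 // monic_prod_XsubC.
- by rewrite size_prod_XsubC /index_enum -enumT size_enum_ord.
- move=> i.
  have pint : integralOver (intr : int -> C) p`_i.
    exact: integral_coef_prod.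
  have [z pz] : exists z : int, p`_i = z%:~R.
    apply: rational_integral pint; apply: Frat; first exact: (polyOverP pF).
    apply/alg_closureP; apply/polyOverP: i; apply: rpred_prod => i _.
    by rewrite polyOverXsubC; apply/alg_closureP/integral_alg.
  exists z => //; rewrite ger0_norm in HP; last by rewrite exprn_ge0 ?addr_ge0 ?exprn_ge0.
  by apply: le_trans HP; apply: prod_XsubC_bound => //; rewrite exprn_ge0.
- have [i ci] := rho_all _ (is_aut_id _).
  by rewrite /root horner_prod (bigD1 i) //= !hornerE -ci // subrr mul0r.
Qed.

End Northcott.

(** * Bounded denominators of logarithms *)

Lemma common_denominator_rat m (r : 'I_m -> rat) :
  exists2 M : nat, (0 < M)%N & exists z : 'I_m -> int, forall i, M%:R * r i = (z i)%:~R.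
Proof.
exists (\prod_i `|denq (r i)|)%N.
  by apply: prodn_gt0 => i; rewrite absz_gt0 denq_eq0.
suff /choice[z zP] : forall i, exists z : int,
    (\prod_i `|denq (r i)|)%N%:R * r i = z%:~R by exists z.
move=> i; exists (numq (r i) * (\prod_(j < m | j != i) `|denq (r j)|)%N%:Z).
have e : `|denq (r i)|%N%:R * r i = (numq (r i))%:~R.
  have -> : (`|denq (r i)|%N%:R : rat) = (denq (r i))%:~R by rewrite -[in RHS]absz_denq.
  by rewrite -[X in _ * X]divq_num_den mulrC divfK // intr_eq0 denq_eq0.
by rewrite (bigD1 i) //= natrM mulrAC e intrM.
Qed.

Section Exponential.
Variables (C : numClosedFieldType) (E : C -> C) (period : C).
Hypotheses (E0 : E 0 = 1) (ED : forall x y, E (x + y) = E x * E y).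
Hypothesis Eker : forall x, E x = 1 -> exists z : int, x = z%:~R * period.
Hypothesis arch : forall x : C, exists n : nat, `|x| <= n%:R.

Lemma E_neq0 x : E x != 0.
Proof.
have : E x * E (- x) != 0 by rewrite -ED subrr E0 oner_eq0.
by apply: contraNneq => ->; rewrite mul0r.
Qed.

Lemma EN x : E (- x) = (E x)^-1.
Proof. by apply: (mulfI (E_neq0 x)); rewrite -ED subrr E0 divff // E_neq0. Qed.

Lemma EMn n x : E (n%:R * x) = E x ^+ n.
Proof.
by elim: n => [|n IHn]; rewrite ?mul0r ?E0 // -natr1 mulrDl mul1r ED IHn exprSr.
Qed.

Lemma EMz (z : int) x : E (z%:~R * x) = E x ^ z.
Proof.
case: z => n; first exact: EMn.
by rewrite NegzE intrN mulNr EN [_%:~R]/(n.+1%:R) EMn.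
Qed.

Lemma E_sum m (x : 'I_m -> C) : E (\sum_i x i) = \prod_i E (x i).
Proof. exact: (big_morph E ED E0). Qed.

Lemma gen_exprz (s : seq C) x (z : int) : x \in gen s -> x ^ z \in gen s.
Proof. by move=> xs; case: z => n; rewrite ?rpredV rpredX. Qed.

Definition zspan m (xs : 'I_m -> C) (y : C) : Prop := exists (z : 'I_m -> int) (w : int),
  y = \sum_i (z i)%:~R * xs i + w%:~R * period.

Lemma zspanMz m (xs : 'I_m -> C) y (a : int) : zspan xs y -> zspan xs (a%:~R * y).
Proof.
move=> [z [w ->]]; exists (fun i => a * z i), (a * w).
rewrite mulrDr mulr_sumr intrM mulrA; congr (_ + _).
by apply: eq_bigr => i _; rewrite intrM mulrA.
Qed.

Lemma zspanMn m (xs : 'I_m -> C) y (a : nat) : zspan xs y -> zspan xs (a%:R * y).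
Proof. exact: (@zspanMz _ _ _ a%:Z). Qed.

Lemma zspan0 m (xs : 'I_m -> C) : zspan xs 0.
Proof. by exists (fun=> 0), 0; rewrite big1 ?mul0r ?addr0 // => i _; rewrite mul0r. Qed.

Lemma zspanD m (xs : 'I_m -> C) y y' : zspan xs y -> zspan xs y' -> zspan xs (y + y').
Proof.
move=> [z [w ->]] [z' [w' ->]]; exists (fun i => z i + z' i), (w + w').
rewrite addrACA -big_split intrD mulrDl; congr (_ + _).
by apply: eq_bigr => i _; rewrite intrD mulrDl.
Qed.

Lemma zspan_mem m (xs : 'I_m -> C) i : zspan xs (xs i).
Proof.
exists (fun j => (j == i)%:Z), 0; rewrite mul0r addr0 (bigD1 i) //= eqxx mul1r big1 ?addr0 //.
by move=> j /negPf->; rewrite mul0r.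
Qed.

Lemma zspan_period m (xs : 'I_m -> C) : zspan xs period.
Proof. by exists (fun=> 0), 1; rewrite big1 ?mul1r ?add0r // => i _; rewrite mul0r. Qed.

Lemma zspan_trans m n (xs : 'I_m -> C) (ys : 'I_n -> C) x :
  (forall i, zspan ys (xs i)) -> zspan xs x -> zspan ys x.
Proof.
move=> xy [z [w ->]]; apply: zspanD; last by apply/zspanMz/zspan_period.
apply: (big_ind (zspan ys)); [exact: zspan0 | exact: zspanD | move=> i _].
exact/zspanMz.
Qed.

Definition qcomb m (xs : 'I_m -> C) (r : 'I_m -> rat) : C := \sum_i ratr (r i) * xs i.

Lemma qcombMn m (xs : 'I_m -> C) r (M : nat) (z : 'I_m -> int) :
  (forall i, M%:R * r i = (z i)%:~R) -> M%:R * qcomb xs r = \sum_i (z i)%:~R * xs i.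
Proof.
move=> zP; rewrite mulr_sumr; apply: eq_bigr => i _.
by rewrite mulrA -[M%:R](rmorph_nat (ratr : {rmorphism rat -> C})) -rmorphM /= zP rmorph_int.
Qed.

Section Field.
Variable s : seq C.

(** Dirichlet's pigeonhole: the fractional parts of t r, for t = 0, ..., |L|, give |L| + 1 values of
    [E] in the finite list [L]. Two agree, so (t' - t) y lies in the span, and t' - t divides
    |L|!. *)
Lemma bounded_denominators_algebraic m (xs : 'I_m -> C) :
    (forall i, E (xs i) \in gen s) -> (forall i, alg (@rational C) (E (xs i))) ->
  exists2 N : nat, (0 < N)%N & forall r, E (qcomb xs r) \in gen s -> zspan xs (N%:R * qcomb xs r).
Proof.
move=> xs_s xs_alg; have [L LP] := northcott arch xs_s xs_alg.
exists (size L)`!; first exact: fact_gt0.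
move=> r ys; set y := qcomb xs r.
pose z (t : 'I_(size L).+1) i := Num.floor (t%:R * r i).
pose f (t : 'I_(size L).+1) i := t%:R * r i - (z t i)%:~R.
have yf t : qcomb xs (f t) = t%:R * y - \sum_i (z t i)%:~R * xs i.
  rewrite /y /qcomb mulr_sumr -sumrB; apply: eq_bigr => i _.
  by rewrite /f rmorphB rmorphM /= rmorph_nat rmorph_int mulrBl -[in LHS]mulrA.
have inL t : E (qcomb xs (f t)) \in L.
  have [M M0 [n nP]] := common_denominator_rat (f t).
  have f01 i : 0 <= f t i < 1.
    have := real_floor_itv (num_real (t%:R * r i)).
    by rewrite -/(z t i) intrD /f => /andP[z0 z1]; rewrite subr_ge0 z0 ltrBlDl.
  apply: (LP _ M (fun i => `|n i|%N)) => //.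
  - rewrite yf ED EN E_sum EMn rpred_div ?rpredX //; apply: rpred_prod => i _.
    by rewrite EMz gen_exprz.
  - move=> i; have := f01 i => /andP[f0 f1].
    have : (n i)%:~R <= M%:R :> rat by rewrite -nP ler_piMr ?ler0n ?ltW.
    have : 0 <= (n i)%:~R :> rat by rewrite -nP mulr_ge0 ?ler0n.
    by rewrite -[M%:R]/(M%:~R) ler0z ler_int; lia.
  - rewrite -EMn (qcombMn _ nP) E_sum; apply: eq_bigr => i _.
    rewrite EMz; have : 0 <= n i; last by case: (n i).
    by rewrite -(ler0z rat) -nP mulr_ge0 ?ler0n //; case/andP: (f01 i).
have [t [t' [tt' Ett']]] : exists t t' : 'I_(size L).+1, (t < t')%N /\ 
    E (qcomb xs (f t)) = E (qcomb xs (f t')).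
  have /injectivePn[t [t' tt' e]] : ~~ injectiveb (fun t => E (qcomb xs (f t))).
    apply/negP => inj.
    have : (size (codom (fun t => E (qcomb xs (f t)))) <= size L)%N.
      by apply: uniq_leq_size => // _ /codomP[t ->].
    by rewrite size_codom card_ord ltnn.
  case: (ltngtP t t') => [lt|gt|/ord_inj eq]; first by exists t, t'.
    by exists t', t.
  by rewrite eq eqxx in tt'.
have [w wP] : exists w : int, qcomb xs (f t') - qcomb xs (f t) = w%:~R * period.
  by apply: Eker; rewrite ED EN Ett' divff // E_neq0.
have : zspan xs ((t' - t)%N%:R * y).
  exists (fun i => z t' i - z t i), w; rewrite -wP !yf.
  rewrite natrB 1?ltnW // (eq_bigr (fun i => (z t' i)%:~R * xs i - (z t i)%:~R * xs i)).
    by rewrite sumrB; ring.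
  by move=> i _; rewrite intrB mulrBl.
have /dvdnP[k ->] : (t' - t %| (size L)`!)%N.
  by rewrite dvdn_fact // subn_gt0 tt' /= (leq_trans (leq_subr _ _)) // -ltnS.
by rewrite natrM -mulrA => /zspanMn; apply.
Qed.

Section Character.
Variable v : C -> int.
Hypothesis vM : forall x y, x \in gen s -> y \in gen s ->
  x != 0 -> y != 0 -> v (x * y) = v x + v y.

Lemma character1 : v 1 = 0.
Proof.
have := vM (rpred1 (gen s)) (rpred1 (gen s)) (oner_neq0 _) (oner_neq0 _).
by rewrite mulr1 => /eqP; rewrite -subr_eq subrr eq_sym => /eqP.
Qed.

Lemma characterX x n : x \in gen s -> x != 0 -> v (x ^+ n) = n%:Z * v x.
Proof.
move=> xs x0; elim: n => [|n IHn]; first by rewrite character1 mul0r.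
by rewrite exprS vM ?rpredX ?expf_neq0 // IHn intS mulrDl mul1r.
Qed.

Lemma characterXz x (z : int) : x \in gen s -> x != 0 -> v (x ^ z) = z * v x.
Proof.
move=> xs x0; case: z => n; first exact: characterX.
have xn0 : x ^+ n.+1 != 0 by rewrite expf_neq0.
have := vM (rpredX n.+1 xs) (_ : x ^ Negz n \in gen s) xn0; rewrite mulfV // character1.
rewrite characterX // NegzE mulNr => /(_ (gen_exprz _ xs)); rewrite invr_eq0 => /(_ xn0).
lia.
Qed.

Lemma character_prod m (x : 'I_m -> C) : (forall i, x i \in gen s) -> (forall i, x i != 0) ->
  v (\prod_i x i) = \sum_i v (x i).
Proof.
elim: m x => [|m IHm] x xs x0; first by rewrite !big_ord0 character1.
rewrite !big_ord_recl vM ?IHm //; first by apply: rpred_prod.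
by rewrite prodf_seq_neq0; apply/allP => i _; rewrite x0.
Qed.

Lemma character_qcomb m (xs : 'I_m -> C) r : (forall i, E (xs i) \in gen s) ->
  E (qcomb xs r) \in gen s -> (v (E (qcomb xs r)))%:~R = \sum_i r i * (v (E (xs i)))%:~R.
Proof.
move=> xss ys; have [M M0 [n nP]] := common_denominator_rat r.
have M0' : (M%:R : rat) != 0 by rewrite pnatr_eq0 -lt0n.
apply: (mulfI M0'); rewrite -[M%:R]/(M%:Z%:~R) -intrM -characterX ?E_neq0 //.
rewrite -EMn (qcombMn _ nP) E_sum character_prod; last first.
- by move=> i; exact: E_neq0.
- by move=> i; rewrite EMz gen_exprz.
rewrite raddf_sum mulr_sumr; apply: eq_bigr => i _ /=.
by rewrite EMz characterXz ?E_neq0 // intrM mulrA -nP.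
Qed.

End Character.

(* Splitting off a direction on which a character of the field is nonzero lowers the rank;
   when no such direction is left, all values are algebraic numbers. *)
Lemma bounded_denominators m (xs : 'I_m -> C) : (forall i, E (xs i) \in gen s) ->
  exists2 N : nat, (0 < N)%N & forall r, E (qcomb xs r) \in gen s -> zspan xs (N%:R * qcomb xs r).
Proof.
elim: m xs => [|m IHm] xs xss.
  by exists 1%N => // r _; rewrite /qcomb big_ord0 mulr0; exact: zspan0.
have [[i0 ni0]|] := pselect (exists i, ~ alg (@rational C) (E (xs i))); last first.
  move=> nex; apply: bounded_denominators_algebraic => // i.
  by apply: contrapT => ni; apply: nex; exists i.
have [v v0 vM] := integral_character (xss i0) ni0.
set a := v (E (xs i0)) in v0.
pose vi i := v (E (xs i)).
(* These combinations lie in the kernel of v o E. *)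
pose xs' j := a%:~R * xs (lift i0 j) - (vi (lift i0 j))%:~R * xs i0.
have [|N N0 NP] := IHm xs'.
  by move=> j; rewrite ED EN !EMz rpred_div ?gen_exprz.
exists (N * `|a|)%N; first by rewrite muln_gt0 N0 absz_gt0.
move=> r ys; set y := qcomb xs r in ys *.
(* v o E is linear in the rational coordinates, so subtracting v(E y) x_i0 from a y removes exactly
   the coordinate [i0]. *)
have E1 : qcomb xs' (fun j => r (lift i0 j)) = a%:~R * y - (v (E y))%:~R * xs i0.
  have -> : ((v (E y))%:~R : C) = ratr ((v (E y))%:~R) by rewrite rmorph_int.
  rewrite (character_qcomb vM xss ys) rmorph_sum /= mulr_suml mulr_sumr -sumrB.
  rewrite (bigD1_ord i0) //= [X in X + _](_ : _ = 0) ?add0r; last first.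
    by rewrite rmorphM /= rmorph_int; ring.
  by apply: eq_bigr => j _; rewrite /xs' /vi rmorphM /= rmorph_int; ring.
have /NP : E (qcomb xs' (fun j => r (lift i0 j))) \in gen s.
  by rewrite E1 ED EN !EMz rpred_div ?gen_exprz.
have xs'_span j : zspan xs (xs' j).
  rewrite /xs' -mulNr -intrN; apply: zspanD; apply: zspanMz; exact: zspan_mem.
move=> /(zspan_trans xs'_span); rewrite E1 mulrBr => /zspanD.
move=> /(_ _ (zspanMn N (zspanMz (v (E y)) (zspan_mem xs i0)))); rewrite subrK.
move=> /(zspanMz (Num.sg a)); congr (zspan _ _).
rewrite natrM -[(`|a|%N)%:R]/((`|a|%N)%:~R) abszE normrEsg.
by rewrite intrM; ring.
Qed.

End Field.
End Exponential.

(** * Relations between radicals and roots of unity *)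

Section Arithmetic.
Local Open Scope nat_scope.

Lemma coprime_inverse a n : 0 < a -> coprime a n -> exists b c, a * b = 1 + n * c.
Proof.
move=> a0 /(coprimeP _ a0)[[b c] /= e]; exists b, c.
lia.
Qed.

Lemma eqmod_coprime x y m : x = y %[mod m] -> coprime y m -> coprime x m.
Proof. by rewrite -(coprime_modl x) => ->; rewrite coprime_modl. Qed.

(* For a prime p dividing n, choose j = 1 mod p if p | a, and a j = 1 mod p otherwise;
   p is odd in the second case. *)
Lemma coprime_progression a n : 0 < n -> 0 < a -> ~~ odd a ->
  exists j, [/\ 0 < j, coprime j n & coprime (1 + a * j) n].
Proof.
move=> n0 a0 ea; pose n1 := n`_\pi(a); pose n2 := n`_\pi(a)^'.
have nE : n1 * n2 = n by rewrite partnC.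
have n12 : coprime n1 n2 by apply: coprime_partC.
have an2 : coprime a n2 by rewrite coprime_pi' ?part_gt0 // part_pnat.
have odd2 : coprime 2 n2.
  rewrite (coprime_dvdl _ an2) //; by rewrite dvdn2.
have [b [c bE]] := coprime_inverse a0 an2.
pose j := chinese n1 n2 1 b + n.
have j1 : j = 1 %[mod n1].
  by rewrite /j -nE addnC mulnC modnMDl chinese_modl.
have j2 : j = b %[mod n2].
  by rewrite /j -nE addnC modnMDl chinese_modr.
have aj : coprime (a * j) n2.
  apply: (eqmod_coprime (y := a * b)); first by rewrite -modnMmr j2 modnMmr.
  by rewrite bE; apply: (eqmod_coprime (y := 1)); rewrite ?coprime1n // addnC mulnC modnMDl.
exists j; split; first by rewrite addn_gt0 n0 orbT.
  rewrite -nE coprimeMr (eqmod_coprime j1) ?coprime1n //=.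
  by move: aj; rewrite coprimeMl => /andP[].
rewrite -nE coprimeMr; apply/andP; split.
  have : coprime (1 + a * j) a.
    by apply: (eqmod_coprime (y := 1)); rewrite ?coprime1n // addnC mulnC modnMDl.
  rewrite !(coprime_sym (1 + _)) coprime_pi' // => aj'.
  by apply: (pnat_coprime (pi := \pi(a))); rewrite ?part_pnat.
apply: (eqmod_coprime (y := 2)) => //.
rewrite -modnDmr -modnMmr j2 modnMmr bE modnDmr addnA addnC mulnC modnMDl //.
Qed.

End Arithmetic.

Section Vandermonde.
Variables (C : fieldType) (n : nat) (t : 'I_n -> C).

Definition nondegenerate := \sum_i t i = 0 /\
  forall I : {set 'I_n}, I != set0 -> I \proper [set: 'I_n] -> \sum_(i in I) t i != 0.

(** Vandermonde by interpolation: [f], of degree below n, vanishes at all values of [w] except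
    [w i0]. The window starts at an arbitrary [j0] because [mann] has to skip a residue class. *)
Lemma power_sums_grouped (w : 'I_n -> C) j0 : (forall i, w i != 0) ->
    (forall j, (j0 <= j < j0 + n)%N -> \sum_i t i * w i ^+ j = 0) ->
  forall i0, \sum_(i | w i == w i0) t i = 0.
Proof.
move=> w0 sums i0; pose f := \prod_(i | w i != w i0) ('X - (w i)%:P).
have sf : (size f <= n)%N.
  rewrite /f -big_filter size_prod_XsubC size_filter.
  have sn : size (index_enum 'I_n) = n by rewrite -[RHS]card_ord cardT enumT.
  rewrite -[leqRHS]sn -(count_predC (fun i => w i != w i0)) -addn1 leq_add2l -has_count.
  by apply/hasP; exists i0; rewrite ?mem_index_enum //= negbK.
have : \sum_i t i * w i ^+ j0 * f.[w i] = 0.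
  under eq_bigr => i _ do rewrite (horner_coef_wide _ sf) mulr_sumr.
  rewrite exchange_big big1 //= => j _.
  under eq_bigr => i _ do rewrite mulrCA -mulrA -exprD.
  by rewrite -mulr_sumr sums ?mulr0 // leq_addr ltn_add2l /=.
rewrite (bigID (fun i => w i == w i0)) /= [X in _ + X]big1 ?addr0; last first.
  move=> i wi; rewrite (_ : f.[w i] = 0) ?mulr0 //; apply/eqP.
  rewrite horner_prod prodf_seq_eq0; apply/hasP; exists i; rewrite ?mem_index_enum //=.
  by rewrite wi hornerXsubC subrr eqxx.
rewrite (eq_bigr (fun i => t i * (w i0 ^+ j0 * f.[w i0]))); last first.
  by move=> i /eqP ->; rewrite mulrA.
rewrite -mulr_suml => /eqP; rewrite mulf_eq0 => /orP[/eqP//|].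
rewrite mulf_eq0 expf_eq0 (negPf (w0 i0)) andbF /= horner_prod prodf_seq_eq0.
by move=> /hasP[i _ /andP[wi]]; rewrite !hornerE subr_eq0 eq_sym (negPf wi).
Qed.

Lemma nondegenerate_power_sums (w : 'I_n -> C) j0 : nondegenerate -> (forall i, w i != 0) ->
    (forall j, (j0 <= j < j0 + n)%N -> \sum_i t i * w i ^+ j = 0) ->
  forall i i', w i = w i'.
Proof.
move=> [_ nd] w0 sums i i'; apply: contrapT => ii'.
have : \sum_(k in [set k | w k == w i']) t k != 0.
  apply: nd; first by apply/set0Pn; exists i'; rewrite inE.
  apply/properP; split; first by apply/subsetP.
  by exists i; rewrite inE //; apply/eqP.
under eq_bigl => k do rewrite inE.
by rewrite (power_sums_grouped w0 sums) eqxx.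
Qed.

End Vandermonde.

Section RootsOfUnity.
Variable C : numClosedFieldType.

Lemma prim_root_exists n : (0 < n)%N -> exists z : C, n.-primitive_root z.
Proof.
pose p : {poly C} := 'X^n - 1; have [r Dp] := closed_field_poly_normal p.
move=> n_gt0; rewrite (monicP _) ?monicXnsubC // scale1r in Dp.
have rn1 : all n.-unity_root r by apply/allP => z; rewrite -root_prod_XsubC -Dp.
have sz_r : (n < (size r).+1)%N.
  by rewrite -(size_prod_XsubC r id) -Dp size_XnsubC.
have [|z] := hasP (has_prim_root n_gt0 rn1 _ sz_r); last by exists z.
by rewrite -separable_prod_XsubC -Dp separable_Xn_sub_1 // pnatr_eq0 -lt0n.
Qed.

(** Over a field with no new algebraic numbers every exponent coprime to N occurs. This one is 1
    modulo M0, so it fixes the M0-th roots of unity and [open_image] yields the same action by an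
    automorphism fixing [s]. *)
Lemma aut_on_unity_roots (s : seq C) : exists2 M0 : nat, (0 < M0)%N & 
  forall N j, (0 < N)%N -> (M0 %| N)%N -> coprime (1 + M0 * j) N ->
  exists2 tau, is_aut (gen s) tau & forall z, z ^+ N = 1 -> tau z = z ^+ (1 + M0 * j).
Proof.
have [F [_ Frat algF]] := relatively_closed_subfield (@rational C).
have [M0 M00 M0P] := open_image algF s; exists M0 => // N j N0 MN co.
have [z0 pz] := prim_root_exists N0.
have [sigma sa sz] := aut_prim_root algF Frat pz co.
have sigmaE z : z ^+ N = 1 -> sigma z = z ^+ (1 + M0 * j).
  by move=> /(prim_rootP pz)[i ->]; rewrite rmorphXn /= sz exprAC.
have [z zM|tau ta tE] := M0P N sigma N0 sa.
  have [k Nk] := dvdnP MN.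
  rewrite sigmaE; last by rewrite Nk mulnC exprM zM expr1n.
  by rewrite exprD expr1 exprM zM expr1n mulr1.
by exists tau => // z zN; rewrite tE // sigmaE.
Qed.

(* Mann's argument: if a prime p divides the exponent e too often, the automorphisms
   z |-> z ^ (1 + (e/p) j) multiply the terms by j-th powers of p-th roots of unity. *)
Lemma mann n (s : seq C) : exists2 N : nat, (0 < N)%N &
  forall (c z : 'I_n -> C) L, (0 < L)%N -> (forall i, c i \in gen s) ->
    (forall i, z i ^+ L = 1) -> nondegenerate (fun i => c i * z i) ->
  forall i i', (z i / z i') ^+ N = 1.
Proof.
have [M0 M00 M0P] := aut_on_unity_roots s.
exists (M0 * n`!)%N; first by rewrite muln_gt0 M00 fact_gt0.
move=> c z L L0 cs zL nd i i0.
(* After this normalization [w i0] is 1, so ratios that coincide are equal to 1. *)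
pose w k := z k / z i0.
have z0 k : z k != 0.
  by apply/negP => /eqP zk; move: (zL k); rewrite zk expr0n; case: (L) L0 => // l _ /eqP; rewrite eq_sym oner_eq0.
have w0 k : w k != 0 by rewrite mulf_neq0 ?invr_eq0.
have {}nd : nondegenerate (fun k => c k * w k).
  have E (P : pred 'I_n) : \sum_(k | P k) c k * w k = (\sum_(k | P k) c k * z k) / z i0.
    by rewrite mulr_suml; apply: eq_bigr => k _; rewrite mulrA.
  case: nd => sum0 nd; split=> [|I I0 IT]; rewrite E ?sum0 ?mul0r //.
  by rewrite mulf_neq0 ?invr_eq0 ?nd.
pose P e := (0 < e)%N && [forall k, w k ^+ e == 1].
have exP : exists e, P e.
  exists L; rewrite /P L0; apply/forallP => k.
  by rewrite /w expr_div_n !zL divr1.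
case: (ex_minnP exP) => e /andP[e0 /forallP we] emin.
have {}we k : w k ^+ e = 1 by apply/eqP.
suff /dvdnP[k ->] : (e %| M0 * n`!)%N by rewrite mulnC exprM -/(w i) we expr1n.
have N0 : (0 < M0 * n`!)%N by rewrite muln_gt0 M00 fact_gt0.
apply/dvdn_partP => // p pe; rewrite p_part pfactor_dvdn //; last first.
  by move: pe; rewrite mem_primes => /andP[].
have pp : prime p by move: pe; rewrite mem_primes => /andP[].
have p0 := prime_gt0 pp.
rewrite leqNgt; apply/negP => lt.
rewrite lognM ?fact_gt0 // in lt.
pose e' := lcmn e M0.
have e'0 : (0 < e')%N by rewrite lcmn_gt0 e0.
have le' : logn p e' = logn p e.
  by rewrite logn_lcm //; apply/maxn_idPl; lia.
have /dvdnP[a e'E] : (M0 %| e')%N by rewrite dvdn_lcmr.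
have a0 : (0 < a)%N by move: e'0; rewrite e'E muln_gt0 => /andP[].
have /dvdnP[b aE] : (p %| a)%N.
  have := le'; rewrite e'E lognM // => h.
  by rewrite -[p]expn1 pfactor_dvdn //; lia.
have b0 : (0 < b)%N by move: a0; rewrite aE muln_gt0 => /andP[].
have e'p : e' = (p * (M0 * b))%N by rewrite e'E aE; ring.
have co j : ~~ (p %| 1 + M0 * (b * j))%N -> coprime (1 + M0 * (b * j)) e'.
  move=> pj; rewrite e'p coprimeMr; apply/andP; split.
    by rewrite coprime_sym prime_coprime.
  apply: (@eqmod_coprime _ 1); last by rewrite coprime1n.
  by rewrite mulnA addnC mulnC modnMDl.
(* If p divides M0 b, every j works. Otherwise p occurs exactly once in e', so the assumption on p
   forces p > n, and n consecutive values of j avoid the single bad class modulo p. *)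
have [j0 j0P] : exists j0, forall j, (j0 <= j < j0 + n)%N -> ~~ (p %| 1 + M0 * (b * j))%N.
  have [[j1 pj1]|nex] := pselect (exists j, p %| 1 + M0 * (b * j))%N; last first.
    by exists 0%N => j _; apply/negP => pj; apply: nex; exists j.
  exists j1.+1 => j /andP[j1j jn]; apply/negP => pj.
  have pMb : ~~ (p %| M0 * b)%N.
    apply/negP => pMb; move: pj1; rewrite mulnA (dvdn_addl _ (dvdn_mulr _ pMb)) dvdn1.
    by move=> /eqP p1; rewrite p1 in pp.
  have : (p %| M0 * b * (j - j1))%N.
    rewrite mulnBr -!mulnA.
    have -> : (M0 * (b * j) - M0 * (b * j1) = (1 + M0 * (b * j)) - (1 + M0 * (b * j1)))%N by lia.
    by rewrite dvdn_sub.
  rewrite Euclid_dvdM // (negPf pMb) /= => /dvdn_leq.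
  rewrite subn_gt0 => /(_ j1j) pj1n.
  have l1 : logn p e' = 1%N.
    rewrite e'p lognM ?muln_gt0 ?M00 ?p0 // logn_prime // eqxx.
    by rewrite lognE (negPf pMb) !andbF.
  have : (0 < logn p n`!)%N.
    by rewrite logn_gt0 mem_primes pp fact_gt0 dvdn_fact // p0 //=; lia.
  by lia.
(* The automorphism of exponent 1 + M0 b j multiplies w_k by the j-th power of w_k^(M0 b); the
   vanishing sums make these factors equal. *)
have wMb k : w k ^+ (M0 * b) = 1.
  have <- : w i0 ^+ (M0 * b) = 1 by rewrite /w divff ?expr1n.
  apply: (nondegenerate_power_sums nd (j0 := j0) (w := fun k => w k ^+ (M0 * b))).
    by move=> k'; rewrite expf_neq0.
  move=> j /j0P/co cj.
  have [|tau [taus _] tauE] := M0P e' (b * j)%N e'0 _ cj; first by rewrite dvdn_lcmr.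
  rewrite -[RHS](rmorph0 tau) -[in RHS](proj1 nd) rmorph_sum; apply: eq_bigr => k' _.
  rewrite rmorphM /= taus // tauE; last first.
    have /dvdnP[q ->] : (e %| e')%N by exact: dvdn_lcml.
    by rewrite mulnC exprM we expr1n.
  by rewrite exprD expr1 -exprM mulnA mulrA.
(* By minimality e divides M0 b = e'/p, although p occurs in e as often as in e'. *)
have : (e <= gcdn e (M0 * b))%N.
  apply: emin; rewrite /P gcdn_gt0 e0; apply/forallP => k.
  have [a' _ /dvdnP[q qE]] := Bezoutl (M0 * b) e0.
  have : w k ^+ (gcdn e (M0 * b) + a' * (M0 * b)) = 1 by rewrite qE mulnC exprM we expr1n.
  by rewrite exprD (mulnC a') exprM wMb expr1n mulr1 => ->.
move=> h; have : gcdn e (M0 * b) = e.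
  by apply/eqP; rewrite eqn_leq h dvdn_leq // dvdn_gcdl.
move=> g; have eMb : (e %| M0 * b)%N by rewrite -g dvdn_gcdr.
have := dvdn_leq_log p _ eMb; rewrite muln_gt0 M00 b0 => /(_ isT).
rewrite -le' e'p lognM ?muln_gt0 ?M00 ?p0 // logn_prime // eqxx; lia.
Qed.

End RootsOfUnity.

Section Radicals.
Variable C : numClosedFieldType.

Lemma alg_radical (k : divringClosed C) e M : (0 < M)%N -> e ^+ M \in k -> alg k e.
Proof.
move=> M0 eM; exists ('X^M - (e ^+ M)%:P); split.
- by rewrite rpredB ?polyOverXn ?polyOverC.
- by rewrite monic_neq0 // monicXnsubC.
- by rewrite /root !hornerE subrr.
Qed.

(* Schinzel's argument: if e generates an abelian extension and tau acts on roots of unity by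
   z |-> z ^ t, then tau e / e ^ t is fixed by every automorphism. *)
Lemma radical_of_abelian (s : seq C) : exists2 M1 : nat, (0 < M1)%N &
  forall e M, (0 < M)%N -> e != 0 -> e ^+ M \in gen s ->
    (forall sigma, is_aut (gen s) sigma -> (forall z, z ^+ M = 1 -> sigma z = z) -> sigma e = e) ->
  exists z k, [/\ z ^+ M = 1, k \in gen s & e ^+ M1 = z * k].
Proof.
have [M0 M00 M0P] := aut_on_unity_roots s.
(* The factor 2 is due to even M: then [j] and [1 + M1 * j] must both be odd, which requires an even
   [M1]. *)
exists (M0 * 2)%N; first by rewrite muln_gt0 M00.
set M1 := (M0 * 2)%N => e M Mgt0 e0 eM abel.
have M10 : (0 < M1)%N by rewrite muln_gt0 M00.
have N0 : (0 < M * M1)%N by rewrite muln_gt0 Mgt0.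
have M1even : ~~ odd M1 by rewrite oddM andbF.
have [j [j0 co1 co2]] := coprime_progression N0 M10 M1even.
have [||tau ta tauE] := M0P (M * M1)%N (2 * j)%N N0.
- by rewrite dvdn_mull // dvdn_mulr.
- by rewrite mulnA.
rewrite mulnA -/M1 in tauE; set t := (1 + M1 * j)%N in tauE co2.
have tauM z : z ^+ M = 1 -> tau z = z ^+ t.
  by move=> zM; apply: tauE; rewrite exprM zM expr1n.
have ratio sigma : is_aut (gen s) sigma -> (sigma e / e) ^+ M = 1.
  by move=> sa; rewrite expr_div_n -rmorphXn (sa.1 _ eM) divff // expf_neq0.
have k1s : tau e / e ^+ t \in gen s.
  have ae := alg_radical Mgt0 eM.
  have ate : alg (gen s) (tau e).
    by apply: (@alg_radical _ _ M) => //; rewrite -rmorphXn /= (ta.1 _ eM).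
  apply: fixed_mem.
    apply: alg_div => //; apply/alg_closureP; rewrite rpredX //; exact/alg_closureP.
  move=> sigma sa; set w := sigma e / e.
  have se : sigma e = w * e by rewrite /w divfK.
  have wM : w ^+ M = 1 by apply: ratio.
  (* [rho] inverts [tau \o sigma], so [rho \o (sigma \o tau)] is a commutator. It fixes the M-th
     roots of unity, where [tau] is a power map, hence it fixes [e] by [abel]. *)
  have comm : sigma (tau e) = tau (sigma e).
    have [rho [ra rK Kr]] := is_aut_inv (is_aut_comp ta sa).
    have /= re : (rho \o (sigma \o tau : {rmorphism C -> C}) : {rmorphism C -> C}) e = e.
      apply: abel => [|z zM /=]; first exact: is_aut_comp ra (is_aut_comp sa ta).
      have szM : sigma z ^+ M = 1 by rewrite -rmorphXn zM rmorph1.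
      by rewrite (tauM z) // rmorphXn -(tauM (sigma z)) //; have /= -> := rK z.
    by rewrite -[LHS]Kr /= re.
  rewrite fmorph_div rmorphXn comm se rmorphM (tauM w wM) [(w * e) ^+ t]exprMn.
  have wt0 : w ^+ t != 0.
    by rewrite expf_neq0 // mulf_neq0 ?invr_eq0 // fmorph_eq0.
  by rewrite -mulf_div divff // mul1r.
(* An inverse b of j modulo M strips j from the exponent M1 j; the surplus is a power of e^M, which
   lies in the field. *)
have [b [c bcE]] : exists b c, (j * b = 1 + M * c)%N.
  by apply: coprime_inverse => //; move: co1; rewrite coprimeMr => /andP[].
set k1 := tau e / e ^+ t in k1s; pose h := tau e / e.
have hM : h ^+ M = 1 by apply: ratio.
have h0 : h != 0 by rewrite mulf_neq0 ?invr_eq0 // fmorph_eq0.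
have eM1j : e ^+ (M1 * j) = h / k1.
  rewrite /h /k1 /t exprD expr1 invf_div mulf_div.
  have te0 : tau e != 0 by rewrite fmorph_eq0.
  by field; rewrite te0 e0.
exists (h ^+ b), (k1 ^- b / (e ^+ M) ^+ (c * M1)); split.
- by rewrite exprAC hM expr1n.
- by apply: rpred_div; [rewrite rpredV; apply: rpredX | apply: rpredX].
have eMc0 : (e ^+ M) ^+ (c * M1) != 0 by rewrite !expf_neq0.
apply: (mulIf eMc0); rewrite -mulrA divfK // -expr_div_n -eM1j -!exprM -(mulnA M1) bcE.
by rewrite -exprD; congr (_ ^+ _); ring.
Qed.

End Radicals.

Section Relations.
Variables (C : numClosedFieldType) (E : C -> C) (period : C).
Hypotheses (E0 : E 0 = 1) (ED : forall x y, E (x + y) = E x * E y).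
Hypotheses (period0 : period != 0) (Eperiod : E period = 1).
Hypothesis Eker : forall x, E x = 1 -> exists z : int, x = z%:~R * period.
Hypothesis arch : forall x : C, exists n : nat, `|x| <= n%:R.

(** The kernel of [E] is generated by the period, so E(period / M) has order exactly M and generates
    the M-th roots of unity. *)
Lemma torsionE M z : (0 < M)%N -> z ^+ M = 1 -> exists r : rat, z = E (ratr r * period).
Proof.
move=> M0 zM; pose w := E (M%:R^-1 * period).
have MC0 : (M%:R : C) != 0 by rewrite pnatr_eq0 -lt0n.
have wi i : w ^+ i = E (ratr (i%:R / M%:R) * period).
  by rewrite -(EMn E0 ED) fmorph_div !rmorph_nat mulrA.
have wM : w ^+ M = 1 by rewrite -(EMn E0 ED) mulrA divff // mul1r.
have [m wm mM] := prim_order_exists M0 wM.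
have mE : m = M.
  apply/eqP; rewrite eqn_leq dvdn_leq //=; apply: dvdn_leq; first exact: prim_order_gt0 wm.
  have : w ^+ m = 1 by apply: prim_expr_order.
  rewrite -(EMn E0 ED) => /Eker[k]; rewrite mulrA => /(mulIf period0) mk.
  have : (m%:Z = k * M%:Z).
    by apply/eqP; rewrite -(eqr_int C) intrM -mk -mulrA mulVf // mulr1.
  move=> mkM; have : (M%:Z %| m%:Z)%Z by apply/dvdzP; exists k.
  by [].
rewrite mE in wm; have [i ->] := prim_rootP wm zM.
by exists (i%:R / M%:R); rewrite wi.
Qed.

(* Applying the powers of sigma to the relation makes all weighted power sums of the
   ratios sigma(E x_i)/E x_i vanish. *)
Lemma kummer_step n (s : seq C) (c x : 'I_n -> C) M : (0 < M)%N -> (forall i, c i \in gen s) ->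
    (forall i, E (x i) ^+ M \in gen s) -> nondegenerate (fun i => c i * E (x i)) ->
  forall sigma, is_aut (gen s) sigma -> (forall z, z ^+ M = 1 -> sigma z = z) ->
  forall i i', sigma (E (x i - x i')) = E (x i - x i').
Proof.
move=> M0 cs xs nd sigma [sa _] sM i i'; pose w k := sigma (E (x k)) / E (x k).
have Ene := E_neq0 E0 ED.
have sE k : sigma (E (x k)) = w k * E (x k) by rewrite /w divfK.
have wM k : sigma (w k) = w k.
  by apply: sM; rewrite expr_div_n -rmorphXn sa // divff // expf_neq0.
have it j k : iter j sigma (E (x k)) = w k ^+ j * E (x k).
  elim: j => [|j IHj]; first by rewrite mul1r.
  by rewrite iterS IHj rmorphM rmorphXn wM sE mulrA -exprSr.
have w0 k : w k != 0 by rewrite mulf_neq0 ?invr_eq0 ?fmorph_eq0.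
have ww : w i = w i'.
  apply: (nondegenerate_power_sums (j0 := 0%N) nd w0) => j _.
  have : iter j sigma (\sum_k c k * E (x k)) = 0.
    by rewrite (proj1 nd); elim: j => //= j ->; rewrite rmorph0.
  move=> it0; rewrite -[RHS]it0; elim: j {it0} => [|j IHj] /=; first by apply: eq_bigr => k _; rewrite mulr1.
  rewrite -IHj rmorph_sum; apply: eq_bigr => k _.
  by rewrite !rmorphM /= sa // rmorphXn wM sE exprS; ring.
by rewrite ED (EN E0 ED) fmorph_div !sE ww -mulf_div divff // mul1r.
Qed.

(** Each x_i - x_i1 is split as u_i + q_i period with N2 u_i in the span. What remains is a relation
    among the roots of unity E(q_i period) with coefficients c_i E(u_i) in the fixed field [gen s'],
    and [mann] bounds the differences of the q_i. *)
Lemma exponents_bounded n (s : seq C) m (xs : 'I_m -> C) : (forall i, E (xs i) \in gen s) ->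
  exists2 N : nat, (0 < N)%N & forall (c : 'I_n -> C) (r : 'I_n -> 'I_m -> rat),
    (forall i, c i \in gen s) -> nondegenerate (fun i => c i * E (qcomb xs (r i))) ->
  forall i i', zspan period xs (N%:R * (qcomb xs (r i) - qcomb xs (r i'))).
Proof.
move=> xss; have Ene := E_neq0 E0 ED.
have [M1 M10 M1P] := radical_of_abelian s.
(* The period joins the generators at index 0, so that the root of unity in E(y)^M1 is absorbed as a
   rational multiple of it. *)
pose xs1 (i : 'I_m.+1) := if unlift ord0 i is Some j then xs j else period.
have xs1s i : E (xs1 i) \in gen s.
  by rewrite /xs1; case: unliftP => [j _|_]; rewrite ?xss // Eperiod rpred1.
have xs1E (q : rat) (f : 'I_m -> rat) : exists g, qcomb xs1 g = qcomb xs f + ratr q * period.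
  exists (fun i => if unlift ord0 i is Some j then f j else q).
  rewrite /qcomb big_ord_recl /xs1 unlift_none addrC; congr (_ + _).
  by apply: eq_bigr => i _; rewrite liftK.
have xs1span i : zspan period xs (xs1 i).
  by rewrite /xs1; case: unliftP => [j _|_]; [exact: zspan_mem | exact: zspan_period].
have [N1 N10 N1P] := bounded_denominators E0 ED Eker arch xs1s.
pose N2 := (N1 * M1)%N; have N20 : (0 < N2)%N by rewrite muln_gt0 N10.
have N2C : (N2%:R : C) != 0 by rewrite pnatr_eq0 -lt0n.
(* With N2 fixed, these finitely many division values generate a field containing every E(u_i),
   whatever the solution. *)
pose s' := s ++ [seq E (xs i / N2%:R) | i <- enum 'I_m].
have ss' : {subset gen s <= gen s'}.
  by apply: gen_sub => x xs_; apply: mem_gen; rewrite mem_cat xs_.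
have [N3 N30 N3P] := mann n s'.
exists (N3 * N2)%N; first by rewrite muln_gt0 N30.
move=> c r cs nd i0 i1; pose x i := qcomb xs (r i).
have [M M0 xM] : exists2 M, (0 < M)%N & forall i, E (x i) ^+ M \in gen s.
  have /choice[f fP] : forall i, exists M, (0 < M)%N /\ E (x i) ^+ M \in gen s.
    move=> i; have [M M0 [z zP]] := common_denominator_rat (r i); exists M; split=> //.
    rewrite -(EMn E0 ED) (qcombMn _ zP) (E_sum E0 ED); apply: rpred_prod => j _.
    by rewrite (EMz E0 ED) gen_exprz.
  exists (\prod_i f i)%N => [|i]; first by apply: prodn_gt0 => i; case: (fP i).
  by rewrite (bigD1 i) //= exprM rpredX //; case: (fP i).
have dec i : exists u (q : rat), [/\ x i - x i1 = u + ratr q * period,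
    zspan period xs (N2%:R * u) & E u \in gen s'].
  pose y := x i - x i1.
  have yE : y = qcomb xs (fun j => r i j - r i1 j).
    by rewrite /y /x /qcomb -sumrB; apply: eq_bigr => j _; rewrite rmorphB mulrBl.
  have eM : E y ^+ M \in gen s.
    rewrite /y ED (EN E0 ED) exprMn exprVn; apply: rpredM; first exact: xM.
    by rewrite rpredV; exact: xM.
  have abel sigma : is_aut (gen s) sigma -> (forall z, z ^+ M = 1 -> sigma z = z) ->
      sigma (E y) = E y.
    by move=> sa sM; apply: (kummer_step M0 cs xM nd sa sM).
  have [z [k [zM ks zk]]] := M1P _ _ M0 (Ene y) eM abel.
  have [q qE] := torsionE M0 zM.
  have [g gE] := xs1E (- q) (fun j => M1%:R * (r i j - r i1 j)).
  have gE' : qcomb xs1 g = M1%:R * y - ratr q * period.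
    rewrite gE rmorphN mulNr yE /qcomb mulr_sumr; congr (_ - _).
    by apply: eq_bigr => j _; rewrite rmorphM /= rmorph_nat -[in LHS]mulrA.
  have : E (qcomb xs1 g) \in gen s.
    rewrite gE' ED (EN E0 ED) (EMn E0 ED) zk qE mulrAC divff ?mul1r //.
  move=> /N1P/(zspan_trans xs1span); rewrite gE' => -[a [w aw]].
  have e1 : N2%:R * (\sum_j (a j)%:~R * (xs j / N2%:R)) = \sum_j (a j)%:~R * xs j.
    by rewrite mulr_sumr; apply: eq_bigr => j _; field.
  have e2 : N2%:R * (ratr ((w%:~R + N1%:R * q) / N2%:R) * period) =
      (w%:~R + N1%:R * ratr q) * period.
    have e0 : ratr (w%:~R + N1%:R * q) = w%:~R + N1%:R * ratr q :> C.
      by rewrite rmorphD rmorphM /= rmorph_int rmorph_nat.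
    by rewrite fmorph_div /= e0 rmorph_nat; field.
  exists (\sum_j (a j)%:~R * (xs j / N2%:R)), ((w%:~R + N1%:R * q) / N2%:R); split.
  - apply: (mulfI N2C); rewrite -/y [RHS]mulrDr e1 e2.
    move/eqP: aw; rewrite mulrBr subr_eq => /eqP aw'; rewrite /N2 natrM -[LHS]mulrA aw'.
    by rewrite [in RHS]mulrDl addrA mulrA.
  - by exists a, 0; rewrite mul0r addr0.
  - rewrite (E_sum E0 ED); apply: rpred_prod => j _; rewrite (EMz E0 ED) gen_exprz //.
    by apply: mem_gen; rewrite mem_cat map_f ?orbT // mem_enum.
have /choice[u /choice[q uq]] := dec.
pose z i := E (ratr (q i) * period).
have [L L0 [k kL]] := common_denominator_rat q.
have zL i : z i ^+ L = 1.
  rewrite /z -(EMn E0 ED) mulrA -(rmorph_nat (ratr : {rmorphism rat -> C})) -rmorphM.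
  by rewrite kL rmorph_int (EMz E0 ED) Eperiod exp1rz.
have nd' : nondegenerate (fun i => c i * E (u i) * z i).
  have P (Q : pred 'I_n) : \sum_(i | Q i) c i * E (u i) * z i =
      (\sum_(i | Q i) c i * E (x i)) / E (x i1).
    rewrite mulr_suml; apply: eq_bigr => i _; have [xu _ _] := uq i.
    by rewrite -!mulrA -ED -xu ED (EN E0 ED).
  case: nd => sum0 nd; split=> [|I I0 IT]; rewrite P ?sum0 ?mul0r //.
  by rewrite mulf_neq0 ?invr_eq0 // nd.
have {}zz : (z i0 / z i1) ^+ N3 = 1.
  apply: (N3P (fun i => c i * E (u i)) z L) => // i.
  by rewrite rpredM ?(ss' _ (cs i)) //; case: (uq i).
have [w wE] : exists w : int, N3%:R * (ratr (q i0) * period - ratr (q i1) * period) = w%:~R * period.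
  by apply: Eker; rewrite (EMn E0 ED) ED (EN E0 ED).
have [x0u z0 _] := uq i0; have [x1u z1 _] := uq i1.
have -> : (N3 * N2)%:R * (x i0 - x i1) =
    N3%:R * (N2%:R * u i0) + N3%:R * ((- 1)%:~R * (N2%:R * u i1)) + N2%:R * (w%:~R * period).
  rewrite -wE natrM.
  have -> : x i0 - x i1 = (x i0 - x i1) - (x i1 - x i1) by rewrite subrr subr0.
  by rewrite x0u x1u; ring.
apply: zspanD; last by apply/zspanMn/zspanMz/zspan_period.
by apply: zspanD; apply: zspanMn => //; apply: zspanMz.
Qed.

End Relations.

(** * Rational linear algebra *)

Section RationalCoordinates.
Variable C : numClosedFieldType.

Definition rcomb d (B : 'I_d -> C) (v : 'rV[rat]_d) : C := \sum_l ratr (v 0 l) * B l.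

Lemma rcomb_mulmx d e (B : 'I_d -> C) (B' : 'I_e -> C) (K : 'M[rat]_(d, e)) v :
  (forall l, B l = rcomb B' (row l K)) -> rcomb B v = rcomb B' (v *m K).
Proof.
move=> BK; rewrite /rcomb; under eq_bigr => l _ do rewrite BK /rcomb mulr_sumr.
rewrite exchange_big; apply: eq_bigr => j _; rewrite !mxE rmorph_sum mulr_suml.
by apply: eq_bigr => l _; rewrite mxE rmorphM mulrA.
Qed.

Lemma rcombD d (B : 'I_d -> C) u v : rcomb B (u + v) = rcomb B u + rcomb B v.
Proof. by rewrite -big_split; apply: eq_bigr => l _; rewrite mxE rmorphD mulrDl. Qed.

Lemma rcombZ d (B : 'I_d -> C) (c : rat) v : rcomb B (c *: v) = ratr c * rcomb B v.
Proof. by rewrite mulr_sumr; apply: eq_bigr => l _; rewrite mxE rmorphM mulrA. Qed.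

Lemma rcombN d (B : 'I_d -> C) v : rcomb B (- v) = - rcomb B v.
Proof. by rewrite -scaleN1r rcombZ rmorphN1 mulN1r. Qed.

(** A generating family of least size is free: a relation with nonzero entry at [l0] would express
    [B l0] through the others. *)
Lemma rational_coordinates m (ys : 'I_m -> C) :
  exists d (B : 'I_d -> C) (A : 'M[rat]_(m, d)),
    (forall i, ys i = rcomb B (row i A)) /\ forall v, rcomb B v = 0 -> v = 0.
Proof.
pose P d := `[< exists (B : 'I_d -> C) (A : 'M[rat]_(m, d)), forall i, ys i = rcomb B (row i A) >].
have exP : exists d, P d.
  exists m; apply/asboolP; exists ys, 1%:M => i.
  rewrite /rcomb (bigD1 i) //= !mxE eqxx rmorph1 mul1r big1 ?addr0 // => j ji.
  by rewrite !mxE eq_sym (negPf ji) rmorph0 mul0r.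
case: (ex_minnP exP) => d /asboolP[B [A AB]] dmin.
exists d, B, A; split=> // v v0; apply: contrapT => /eqP/rV0Pn[l0 vl0].
case: d => [|d] in B A AB dmin v v0 l0 vl0 *; first by case: l0 vl0.
suff /dmin : P d by rewrite ltnn.
pose K : 'M[rat]_(d.+1, d) := \matrix_(l, j)
  if unlift l0 l is Some l' then (l' == j)%:R else - v 0 (lift l0 j) / v 0 l0.
apply/asboolP; exists (fun j => B (lift l0 j)), (A *m K) => i.
rewrite AB row_mul; apply: rcomb_mulmx => l; rewrite /rcomb.
case: (unliftP l0 l) => [l'|] ->.
  rewrite (bigD1 l') //= !mxE liftK eqxx rmorph1 mul1r big1 ?addr0 // => j jl.
  by rewrite !mxE liftK eq_sym (negPf jl) rmorph0 mul0r.
have v0C : ratr (v 0 l0) != 0 :> C by rewrite fmorph_eq0.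
apply: (mulfI v0C); move: v0; rewrite /rcomb (bigD1_ord l0) //= => /eqP; rewrite addr_eq0 => /eqP ->.
rewrite mulr_sumr -sumrN; apply: eq_bigr => j _.
by rewrite !mxE unlift_none fmorph_div rmorphN /=; field.
Qed.

Lemma common_denominator_mx m n (A : 'M[rat]_(m, n)) : exists2 M : nat, (0 < M)%N &
  exists Z : 'M[int]_(m, n), M%:R *: A = map_mx intr Z.
Proof.
have /choice[f fP] : forall i, exists M : nat, (0 < M)%N /\ exists z : 'I_n -> int, forall j, M%:R * A i j = (z j)%:~R.
  by move=> i; have [M M0 MP] := common_denominator_rat (A i); exists M.
exists (\prod_i f i)%N; first by apply: prodn_gt0 => i; case: (fP i).
have /choice[z zP] : forall i, exists z : 'I_n -> int, forall j, (\prod_i f i)%N%:R * A i j = (z j)%:~R.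
  move=> i; have [_ [z zP]] := fP i; exists (fun j => (\prod_(k | k != i) f k)%N%:Z * z j) => j.
  by rewrite (bigD1 i) //= natrM mulrAC zP intrM mulrC.
by exists (\matrix_(i, j) z i j); apply/matrixP => i j; rewrite !mxE zP.
Qed.

Definition integral_mx m n (A : 'M[rat]_(m, n)) : Prop := exists Z : 'M[int]_(m, n), A = map_mx intr Z.

Lemma integral_mulmx m n p (A : 'M[rat]_(m, n)) (B : 'M[rat]_(n, p)) :
  integral_mx A -> integral_mx B -> integral_mx (A *m B).
Proof. by move=> [Z ->] [Z' ->]; exists (Z *m Z'); rewrite map_mxM. Qed.

(** The values [rcomb (a i) u], written in a rational basis as u K, determine u modulo V; joined
    with the projection Q to V along V' they determine u, so a right inverse X exists. On V' the
    Q-part is zero, and u is recovered with the denominators of [A] and [X] only. *)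
Lemma bounded_preimage t (I : finType) m (xs : 'I_m -> C) (a : I -> 'I_t -> C)
    (V V' : {vspace 'rV[rat]_t}) :
    (V + V' = fullv)%VS -> (V :&: V' = 0)%VS ->
    (forall i j, exists r : 'I_m -> rat, a i j = qcomb xs r) ->
    (forall u, (forall i, rcomb (a i) u = 0) -> u \in V) ->
  exists2 N : nat, (0 < N)%N & forall u, u \in V' ->
    (forall i, exists z : 'I_m -> int, rcomb (a i) u = \sum_k (z k)%:~R * xs k) ->
  integral_mx (N%:R *: u).
Proof.
move=> VV' cap aspan aV.
have [d [B [A [AB Bfree]]]] := rational_coordinates xs.
have rcombI u v : rcomb B u = rcomb B v -> u = v.
  move=> e; apply/eqP; rewrite -subr_eq0; apply/eqP/Bfree.
  by rewrite rcombD rcombN e subrr.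
have xsE (r : 'I_m -> rat) : qcomb xs r = rcomb B ((\row_k r k) *m A).
  rewrite -(rcomb_mulmx _ AB); apply: eq_bigr => k _; by rewrite mxE.
have /choice[D DE] : forall i, exists D : 'M[rat]_(t, d), forall u, rcomb (a i) u = rcomb B (u *m D).
  move=> i; have /choice[r rE] := aspan i.
  exists (\matrix_j ((\row_k r j k) *m A)) => u; apply: rcomb_mulmx => j.
  by rewrite rowK rE xsE.
pose K : 'M[rat]_(t, #|{: I * 'I_d}|) := \matrix_(j, k) D (enum_val k).1 j (enum_val k).2.
have KE u i l : (u *m D i) 0 l = (u *m K) 0 (enum_rank (i, l)).
  by rewrite !mxE; apply: eq_bigr => j _; rewrite mxE enum_rankK.
pose Q := lin1_mx (daddv_pi V V').
have /row_freeP[X KQX] : row_free (row_mx K Q).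
  apply: inj_row_free => u; rewrite mul_mx_row -row_mx0 => /eq_row_mx[uK uQ].
  have uV : u \in V.
    apply: aV => i; rewrite DE (_ : u *m D i = 0).
      by rewrite /rcomb big1 // => l _; rewrite mxE rmorph0 mul0r.
    by apply/rowP => l; rewrite KE uK !mxE.
  move: uQ; rewrite mul_rV_lin1. move=> <-; apply: esym; exact: daddv_pi_id.
have [M1 M10 [Z1 Z1E]] := common_denominator_mx A.
have [M2 M20 [Z2 Z2E]] := common_denominator_mx (usubmx X).
exists (M1 * M2)%N; first by rewrite muln_gt0 M10.
move=> u uV' uz.
have uQ : u *m Q = 0.
  have cap' : (V' :&: V = 0)%VS by rewrite capvC.
  have := daddv_pi_add cap (_ : u \in (V + V')%VS); rewrite VV' memvf => /(_ isT).
  rewrite (daddv_pi_id cap' uV') mul_rV_lin1 => /eqP.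
  by rewrite -[X in _ == X]add0r => /eqP/addIr.
have uE : u = u *m K *m usubmx X.
  rewrite -[LHS]mulmx1 -KQX -{1}[X]vsubmxK mul_row_col mulmxDr !mulmxA uQ mul0mx addr0 //.
have uK : integral_mx (M1%:R *: (u *m K)).
  have /choice[z zE] : forall i, exists z : 'rV[int]_d, M1%:R *: (u *m D i) = map_mx intr z.
    move=> i; have [z zE] := uz i; exists ((\row_k z k) *m Z1).
    rewrite map_mxM -Z1E -scalemxAr; congr (_ *: _); apply: rcombI.
    rewrite -DE zE -(rcomb_mulmx _ AB); apply: eq_bigr => k _.
    by rewrite !mxE rmorph_int.
  exists (\row_k z (enum_val k).1 0 (enum_val k).2); apply/rowP => k.
  have := congr1 (fun w : 'rV[rat]_d => w 0 (enum_val k).2) (zE (enum_val k).1).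
  by rewrite !mxE => <-; congr (_ * _); apply: eq_bigr => j _; rewrite !mxE.
have -> : (M1 * M2)%:R *: u = (M1%:R *: (u *m K)) *m (M2%:R *: usubmx X).
  by rewrite -scalemxAl -scalemxAr scalerA -natrM -uE.
by apply: integral_mulmx => //; exists Z2.
Qed.

End RationalCoordinates.

Local Open Scope complex_scope.

(** * The complex exponential *)

Section ComplexExponential.
Variable R : realType.

Definition period : R[i] := 0 +i* (pi *+ 2).

Lemma period_neq0 : period != 0.
Proof. by rewrite eq_complex /= eqxx /= mulrn_eq0 /= gt_eqF // pi_gt0. Qed.

Lemma cexp_period : cexp period = 1.
Proof. by rewrite /cexp /= expR0 cos2pi sin2pi mul1r. Qed.

Lemma cexp_int_period (z : int) : cexp (z%:~R * period) = 1.
Proof. by rewrite (EMz (@cexp0 R) (@cexpD R)) cexp_period exp1rz. Qed.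

Lemma cos_eq1 (y : R) : 0 <= y < pi *+ 2 -> cos y = 1 -> y = 0.
Proof.
move=> /andP[y0 y2] cy; apply/eqP; rewrite eq_le y0 andbT leNgt; apply/negP => ygt.
have yE : y = (y / 2) *+ 2 by rewrite -mulr_natr divfK // pnatr_eq0.
have : sin (y / 2) ^+ 2 = 0.
  by rewrite sin2cos2; move: cy; rewrite {1}yE cos_mulr2n => h; lra.
move/eqP; rewrite sqrf_eq0 => /eqP s0.
have : 0 < sin (y / 2).
  by apply: sin_gt0_pi; apply/andP; split; [lra | move: y2; rewrite mulr2n; lra].
by rewrite s0 ltxx.
Qed.

Lemma cexp_eq1 (x : R[i]) : cexp x = 1 -> exists z : int, x = z%:~R * period.
Proof.
have pi2 : 0 < pi *+ 2 :> R by rewrite mulrn_wgt0 // pi_gt0.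
pose z := Num.floor (complex.Im x / (pi *+ 2)).
pose y := x - z%:~R * period.
move=> x1; exists z.
have : cexp y = 1.
  by rewrite /y cexpD (EN (@cexp0 R) (@cexpD R)) cexp_int_period invr1 mulr1.
have -> : x = y + z%:~R * period by rewrite subrK.
have zp : z%:~R * period = 0 +i* (z%:~R * (pi *+ 2)).
  rewrite -(rmorph_int (real_complex R)); apply/eqP; rewrite eq_complex /=.
  by rewrite !mul0r !mulr0 subr0 addr0 !eqxx.
have : 0 <= complex.Im y < pi *+ 2.
  have := real_floor_itv (num_real (complex.Im x / (pi *+ 2))); rewrite -/z.
  rewrite ler_pdivlMr // ltr_pdivrMr // intrD mulrDl mul1r /y zp.
  by case: (x) => a b /= /andP[h1 h2]; apply/andP; split; lra.
case: y => [a b] /= b01; rewrite /cexp /= => /eqP.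
rewrite eq_complex /= !mul0r subr0 addr0 => /andP[/eqP ec /eqP es].
have e2 : expR a ^+ 2 = 1.
  transitivity (expR a ^+ 2 * (cos b ^+ 2 + sin b ^+ 2)); first by rewrite cos2Dsin2 mulr1.
  by rewrite mulrDr -!exprMn ec es expr1n expr0n /= addr0.
have a0 : a = 0.
  apply: expR_inj; rewrite expR0; move/eqP: e2; rewrite sqrf_eq1 => /orP[/eqP//|/eqP e].
  by have := expR_gt0 a; rewrite e ltr0N1.
have b0 : b = 0.
  apply: cos_eq1 => //; move: ec; by rewrite a0 expR0 mul1r.
by rewrite a0 b0 add0r.
Qed.

Lemma complex_arch (x : R[i]) : exists n : nat, `|x| <= n%:R.
Proof.
case: x => a b; rewrite normc_def /=; set r := Num.sqrt _.
exists (Num.bound r); rewrite -(rmorph_nat (real_complex R)) lecR.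
by rewrite ltW // archi_boundP // sqrtr_ge0.
Qed.

End ComplexExponential.

Lemma sum_mem (C : fieldType) (K : divringClosed C) (T : Type) (l : seq T) (F G : T -> C) :
  {subset [seq F m | m <- l] <= K} -> (forall m, G m \in K) -> \sum_(m <- l) F m * G m \in K.
Proof.
move=> FK GK; elim: l FK => [|m l IHl] FK; first by rewrite big_nil rpred0.
rewrite big_cons; apply: rpredD; first by apply: rpredM; [apply: FK; exact: mem_head | exact: GK].
by apply: IHl => x xl; apply: FK; rewrite inE xl orbT.
Qed.

Theorem theorem1p1 (R : realType) (s t : nat)
    (P : 'I_s -> mpoly.mpoly t R[i]) (alpha : 'I_s -> 'rV[R[i]]_t)
    (V' : {vspace 'rV[rat]_t})
    (sumV : (coincidence_space alpha + V' = fullv)%VS)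
    (capV : (coincidence_space alpha :&: V' = 0)%VS) :
  exists2 N : nat, (0 < N)%N &
    forall q : 'rV[rat]_t,
      nondegenerate_solution P alpha (rat_point R q) ->
      forall j : 'I_t, exists m : int,
        daddv_pi V' (coincidence_space alpha) q 0 j = m%:~R / N%:R.
Proof.
set V := coincidence_space alpha in sumV capV *.
have E0 := @cexp0 R; have ED := @cexpD R.
pose I := ('I_s * 'I_t)%type.
pose xs (k : 'I_#|{: I}|) := alpha (enum_val k).1 0 (enum_val k).2.
pose S : seq R[i] := [seq cexp (xs k) | k <- enum 'I_#|{: I}|] ++
  flatten [seq [seq mpoly.mcoeff m (P i) | m <- mpoly.msupp (P i)] | i <- enum 'I_s].
have xsS k : cexp (xs k) \in gen S.
  by apply: mem_gen; rewrite mem_cat; apply/orP; left; apply/mapP; exists k; rewrite ?mem_enum.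
(* Rational coordinates lie in every subfield, so P_i(q) stays in one field for all q. *)
have PS i q : mpoly.meval (fun j => rat_point R q 0 j) (P i) \in gen S.
  rewrite mpoly.mevalE; apply: sum_mem => [c cP|m].
    apply: mem_gen; rewrite mem_cat; apply/orP; right; apply/flatten_mapP.
    by exists i; rewrite ?mem_enum.
  by apply: rpred_prod => j _; apply: rpredX; rewrite mxE rpred_div ?rpred_int.
have [N1 N10 N1P] := exponents_bounded E0 ED (period_neq0 R) (cexp_period R)
  (@cexp_eq1 R) (@complex_arch R) s xsS.
pose r (q : 'rV[rat]_t) (i : 'I_s) (k : 'I_#|{: I}|) : rat :=
  if (enum_val k).1 == i then q 0 (enum_val k).2 else 0.
have rE q i : qcomb xs (r q i) = dot (rat_point R q) (alpha i).
  rewrite /qcomb /r /xs -(big_enum_val (fun ij : I => ratr (if ij.1 == i then q 0 ij.2 else 0) *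
    alpha ij.1 0 ij.2)) /=.
  rewrite -(pair_bigA _ (fun i' j => ratr (if i' == i then q 0 j else 0) * alpha i' 0 j)) /=.
  rewrite (bigD1 i) //= eqxx [X in _ + X]big1 ?addr0 => [|i' /negPf->]; last first.
    by rewrite big1 // => j _; rewrite rmorph0 mul0r.
  by apply: eq_bigr => j _; rewrite mxE.
(* With the period as an extra generator, [zspan] becomes the plain integer span that
   [bounded_preimage] expects. *)
pose xs1 (k : 'I_#|{: I}|.+1) := if unlift ord0 k is Some j then xs j else period R.
(* The common kernel of these forms is V. *)
pose a (ii : 'I_s * 'I_s) (j : 'I_t) : R[i] := alpha ii.1 0 j - alpha ii.2 0 j.
have aE ii u : rcomb (a ii) u = dot (rat_point R u) (alpha ii.1) - dot (rat_point R u) (alpha ii.2).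
  by rewrite /dot -sumrB; apply: eq_bigr => j _; rewrite mxE mulrBr.
have [|u au|N2 N20 N2P] := bounded_preimage (xs := xs1) (a := a) sumV capV.
- move=> ii j.
  pose f (k : 'I_#|{: I}|) : rat := (k == enum_rank (ii.1, j))%:R - (k == enum_rank (ii.2, j))%:R.
  exists (fun k => if unlift ord0 k is Some k' then f k' else 0).
  rewrite /qcomb big_ord_recl unlift_none rmorph0 mul0r add0r.
  have delta k0 : \sum_k ratr (k == k0)%:R * xs k = xs k0.
    rewrite (bigD1 k0) //= eqxx rmorph1 mul1r big1 ?addr0 // => k /negPf->.
    by rewrite rmorph0 mul0r.
  have axs i : alpha i 0 j = xs (enum_rank (i, j)) by rewrite /xs enum_rankK.
  rewrite /a !axs -!delta -sumrB; apply: eq_bigr => k _.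
  by rewrite /xs1 liftK /f rmorphB mulrBl.
- apply/mem_coincidence_space => i i'; apply/eqP; rewrite -subr_eq0; apply/eqP.
  by rewrite -(aE (i, i')) au.
exists (N2 * N1)%N; first by rewrite muln_gt0 N20.
move=> q [sol nd] j; pose u := daddv_pi V' V q.
have uV' : u \in V' by apply: memv_pi.
have capV' : (V' :&: V = 0)%VS by rewrite capvC.
have VV' : (V' + V = fullv)%VS by rewrite addvC.
(* q and u differ by an element of V, on which all dot products agree, so the differences do not
   change. *)
have uq i i' : dot (rat_point R u) (alpha i) - dot (rat_point R u) (alpha i') =
   qcomb xs (r q i) - qcomb xs (r q i').
  rewrite !rE -!(aE (i, i')) -[q in RHS](daddv_pi_add capV') ?VV' ?memvf // rcombD.
  have /mem_coincidence_space vV : daddv_pi V V' q \in coincidence_space alpha by apply: memv_pi.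
  by rewrite -/u [X in _ + X]aE /= (vV i i') subrr addr0.
(* By the choice of N1 the forms take integral values at N1 u; hence the constant N2 N1. *)
have [|ii|Z ZE] := N2P (N1%:R *: u).
- by rewrite memvZ.
- have ndt : nondegenerate (fun i => mpoly.meval (fun j => rat_point R q 0 j) (P i) * cexp (qcomb xs (r q i))).
    suff -> : (fun i => mpoly.meval (fun j => rat_point R q 0 j) (P i) * cexp (qcomb xs (r q i))) =
      exp_term P alpha (rat_point R q) by split.
    by apply/funext => i; rewrite rE.
  have [z [w zw]] := N1P _ _ (fun i => PS i q) ndt ii.1 ii.2.
  exists (fun k => if unlift ord0 k is Some j then z j else w).
  rewrite rcombZ aE uq rmorph_nat zw big_ord_recl /xs1 unlift_none addrC; congr (_ + _).
  by apply: eq_bigr => k _; rewrite liftK.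
exists (Z 0 j).
have := congr1 (fun v : 'rV[rat]_t => v 0 j) ZE; rewrite !mxE => <-.
have N1q : (N1%:R : rat) != 0 by rewrite pnatr_eq0 -lt0n.
have N2q : (N2%:R : rat) != 0 by rewrite pnatr_eq0 -lt0n.
by rewrite natrM; field; rewrite N1q N2q.
Qed.
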